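(* Let $(\mu^{(m)},W^{(m)})_{m\in\mathbb{N}}$ be a sequence in $\mathcal{W}\mathcal{F}(n)$ and let $(\mu,W)\in\mathcal{W}\mathcal{F}(n)$. Then $$d_{\overline{M}}\big((\mu^{(m)},W^{(m)}),(\mu,W)\big)\xrightarrow[m\to+\infty]{}0$$ if and only if $(\mu^{(m)},W^{(m)})$ converges to $(\mu,W)$ in $\mathcal{W}\mathcal{F}(n)$ for the quotient topology.
   Context: Fix an integer $n\ge 1$; $\mathrm{O}(n)$ is the orthogonal group, $\mathrm{Skew}(n)$ the space of real skew-symmetric $n\times n$ matrices. **Flags.** A type is a tuple $I=(p_1,\dots,p_r)$ of positive integers with $p_1+\dots+p_r=n$. $\mathrm{O}(I)\subset\mathrm{O}(n)$ is the subgroup of block-diagonal matrices $\mathrm{diag}(R_1,\dots,R_r)$, $R_i\in\mathrm{O}(p_i)$. $\mathcal{F}_I=\mathrm{O}(n)/\mathrm{O}(I)$ (quotient by right multiplication) carries the quotient topology and the unique smooth structure making the quotient map $\pi_I:\mathrm{O}(n)\to\mathcal{F}_I$ a smooth submersion. **Weighted flags.** $\Delta(n)=\{\mu\in[0,1]^n:\sum_i\mu_i=1\}$. For $\mu\in\Delta(n)$ let $k_1<\dots<k_s$ be the indices $i$ with $\mu_i>0$. The type $\tau(\mu)$ is $(k_1,k_2-k_1,\dots,k_s-k_{s-1})$ if $k_s=n$, and $(k_1,k_2-k_1,\dots,k_s-k_{s-1},n-k_s)$ if $k_s<n$. On $\Delta(n)\times\mathrm{O}(n)$ put $(\alpha,U)\sim(\beta,V)$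 iff $\alpha=\beta$ and $\pi_{\tau(\alpha)}(U)=\pi_{\tau(\alpha)}(V)$. $\mathcal{W}\mathcal{F}(n)=(\Delta(n)\times\mathrm{O}(n))/\!\sim$ has the quotient topology; its elements are written $(\mu,W)$ with $\mu\in\Delta(n)$, $W\in\mathcal{F}_{\tau(\mu)}$. **The top cell and the metric $g$.** $M(n)=\{(\mu,W)\in\mathcal{W}\mathcal{F}(n):\mu_i>0\ \forall i\}=\mathring\Delta(n)\times\mathcal{F}_{(1,\dots,1)}$, where $\mathring\Delta(n)=\{\mu\in\Delta(n):\mu_i>0\ \forall i\}$ (product smooth structure), with $T_\mu\mathring\Delta(n)=\{\alpha\in\mathbb{R}^n:\sum\alpha_i=0\}$. Fix $f:[0,1]^n\to\mathbb{R}_+$ Lipschitz continuous on $[0,1]^n$, $C^2$ on $[0,1]^n\setminus\{0\}$, with $f(\mu)=0$ iff $\mu=0$. For $i<j$, $\mu_{i\to j}\in[0,1]^n$ has $l$-th entry $\mu_l$ if $i\le l\le j-1$ and $0$ otherwise. For $(\mu,W)\in M(n)$, $W=\pi_{(1,\dots,1)}(U)$, and tangent vectors $(\alpha,X),(\beta,Y)$, let $B=(b_{ij}),C=(c_{ij})\in\mathrm{Skew}(n)$ be the unique matrices with $X=T_U\pi_{(1,\dots,1)}\cdot UB$, $Y=T_U\pi_{(1,\dots,1)}\cdot UC$; then $$g_{\mu,W}((\alpha,X),(\beta,Y))=\sum_{i=1}^n\alpha_i\beta_i+\sum_{1\le i<j\le n}f(\mu_{i\to j})^2b_{ij}c_{ij}.$$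 **Length and distance on $\mathcal{W}\mathcal{F}(n)$.** A continuous $\gamma:[a,b]\to\mathcal{W}\mathcal{F}(n)$ is a piecewise $C^1$ path if there are $a=a_0<a_1<\dots<a_N=b$ such that for every $i$, $\gamma(]a_{i-1},a_i[)\subset M(n)$ and $\gamma|_{]a_{i-1},a_i[}$ extends to $[a_{i-1},a_i]$ as a $C^1$ path in the manifold with boundary $\Delta(n)\times\mathcal{F}_{(1,\dots,1)}$ (with its product structure). Its length is $L_{\overline{M}}(\gamma)=\int_a^b\sqrt{g_{\gamma(t)}(\dot\gamma(t),\dot\gamma(t))}\,dt$ (finitely many times $a_i$ are disregarded), and $d_{\overline{M}}(p,q)$ is the infimum of $L_{\overline{M}}(\gamma)$ over piecewise $C^1$ paths $\gamma:[0,1]\to\mathcal{W}\mathcal{F}(n)$ with $\gamma(0)=p$, $\gamma(1)=q$. *)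

(* Defs.v *)
From HB Require Import structures.
From mathcomp Require Import all_boot all_order all_algebra.
From mathcomp Require Import all_classical all_reals all_analysis.
Set Implicit Arguments.
Unset Strict Implicit.
Unset Printing Implicit Defensive.
Import Order.TTheory GRing.Theory Num.Theory.
Import numFieldNormedType.Exports.
Local Open Scope classical_set_scope.
Local Open Scope ring_scope.
Local Open Scope quotient_scope.

Definition is_type (n : nat) (I : seq nat) : bool :=
  all (leq 1%N) I && (\sum_(i < size I) nth 0 I i == n)%N.

Definition flag_type (n : nat) : Type := {I : seq nat | is_type n I}.

Lemma flag_type_sum n (I : flag_type n) :
  (\sum_(i < size (sval I)) nth 0 (sval I) i = n)%N.
Proof. by case: I => I /= /andP[_ /eqP]. Qed.

Lemma is_type_ones n : is_type n (nseq n 1%N).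
Proof.
apply/andP; split; first by apply/allP => x /nseqP[->].
apply/eqP; rewrite size_nseq (eq_bigr (fun=> 1%N)).
  by rewrite sum1_card card_ord.
by move=> i _; rewrite nth_nseq ltn_ord.
Qed.

Definition ones (n : nat) : flag_type n := exist (fun I => is_type n I) _ (is_type_ones n).

Definition orth (R : realType) (n : nat) : set 'M[R]_n :=
  [set U | U^T *m U = 1%:M].

Definition skew (R : realType) (n : nat) : set 'M[R]_n := [set B | B^T = - B].

Definition orth_block (R : realType) (n : nat) (I : flag_type n) :
    set 'M[R]_n :=
  [set U | exists B : forall i : 'I_(size (sval I)), 'M[R]_(nth 0%N (sval I) i),
     (forall i, orth (B i)) /\
     U = castmx (flag_type_sum I, flag_type_sum I) (\mxdiag_i B i)].

Definition flag_rel (R : realType) (n : nat) (I : flag_type n) :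
    rel (@orth R n) :=
  fun U V => `[< exists2 Q, orth_block I Q & set_val V = set_val U *m Q >].

Lemma orth_block1 (R : realType) n (I : flag_type n) :
  orth_block I (1%:M : 'M[R]_n).
Proof.
exists (fun i => 1%:M); split=> [i|].
  by rewrite /orth /= trmx1 mul1mx.
rewrite mxdiagZ; move: (flag_type_sum I) => e.
by apply/matrixP => i j; rewrite castmxE !mxE -!val_eqE /=.
Qed.

Lemma castmx_mul (R : realType) n m (e : m = n) (A B : 'M[R]_m) :
  castmx (e, e) A *m castmx (e, e) B = castmx (e, e) (A *m B).
Proof. by case: n / e. Qed.

Lemma mxdiag_mul (R : realType) k (p_ : 'I_k -> nat)
    (B C : forall i, 'M[R]_(p_ i)) :
  (\mxdiag_i B i) *m (\mxdiag_i C i) = \mxdiag_i (B i *m C i).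
Proof.
rewrite {2}/mxdiag mul_mxdiag_mxblock; apply/eq_mxblock => i j.
have [<-|_] := eqVneq i j; last by rewrite mulmx0.
by rewrite !conform_mx_id.
Qed.

Lemma orth_blockM (R : realType) n (I : flag_type n) (P Q : 'M[R]_n) :
  orth_block I P -> orth_block I Q -> orth_block I (P *m Q).
Proof.
move=> [B [oB ->]] [C [oC ->]]; exists (fun i => B i *m C i); split=> [i|].
  rewrite /orth /= trmx_mul mulmxA -(mulmxA (C i)^T).
  by rewrite (oB i : _ = _) mulmx1; exact: oC.
by rewrite castmx_mul mxdiag_mul.
Qed.

Lemma orth_blockT (R : realType) n (I : flag_type n) (P : 'M[R]_n) :
  orth_block I P -> orth_block I P^T.
Proof.
move=> [B [oB ->]]; exists (fun i => (B i)^T); split=> [i|].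
  by rewrite /orth /= trmxK; apply: mulmx1C; exact: oB.
by rewrite trmx_cast tr_mxdiag.
Qed.

Lemma orth_block_orth (R : realType) n (I : flag_type n) (P : 'M[R]_n) :
  orth_block I P -> orth P.
Proof.
move=> [B [oB ->]]; rewrite /orth /= trmx_cast tr_mxdiag /= castmx_mul.
rewrite mxdiag_mul (_ : (\mxdiag_i _) = 1%:M).
  move: (flag_type_sum I) => e.
  by apply/matrixP => i j; rewrite castmxE !mxE -!val_eqE /=.
by rewrite -mxdiagZ; apply/eq_mxdiag => i; exact: oB.
Qed.

Lemma flag_rel_equiv (R : realType) (n : nat) (I : flag_type n) :
  equiv_class_of (@flag_rel R n I).
Proof.
have sym : symmetric (@flag_rel R n I).
  suff H U V : flag_rel I U V -> @flag_rel R n I V U.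
    by move=> U V; apply/idP/idP; exact: H.
  move=> /asboolP[Q oQ VE]; apply/asboolP; exists Q^T; first exact: orth_blockT.
  rewrite VE -mulmxA (_ : Q *m Q^T = 1%:M) ?mulmx1//.
  by apply: mulmx1C; exact: orth_block_orth oQ.
split=> // [U|V U T].
  by apply/asboolP; exists 1%:M; [exact: orth_block1|rewrite mulmx1].
move=> /asboolP[P oP VE] /asboolP[Q oQ TE]; apply/asboolP.
by exists (P *m Q); [exact: orth_blockM|rewrite TE VE mulmxA].
Qed.

Canonical flag_equiv (R : realType) (n : nat) (I : flag_type n) :=
  EquivRelPack (@flag_rel_equiv R n I).

Definition flag (R : realType) (n : nat) (I : flag_type n) :=
  quotient_topology {eq_quot @flag_equiv R n I}.

Definition flag_pi (R : realType) (n : nat) (I : flag_type n)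
  (U : @orth R n) : flag R I := \pi_(flag R I) U.

Definition cube (R : realType) (n : nat) : set 'rV[R]_n :=
  [set mu | forall i, 0 <= mu 0 i <= 1].

Definition simplex (R : realType) (n : nat) : set 'rV[R]_n :=
  [set mu | cube mu /\ \sum_i mu 0 i = 1].

(* The positions k_1 < ... < k_s are 1-based; appending n when k_s < n makes
   both cases of the definition the list of consecutive differences. *)
Definition tau_seq (R : realType) (n : nat) (mu : 'rV[R]_n) : seq nat :=
  let k := [seq (nat_of_ord i).+1 | i <- enum 'I_n & 0 < mu 0 i] in
  pairmap (fun a b => b - a)%N 0%N (if last 0%N k == n then k else rcons k n).

Lemma tau_seq_type (R : realType) (n : nat) (mu : 'rV[R]_n) :
  is_type n (tau_seq mu).
Proof.
rewrite /tau_seq; set k := map _ _.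
set k' := if _ then _ else _.
have sk : path ltn 0%N k.
  have : sorted ltn (0%N :: map succn (map (@nat_of_ord n)
                       [seq i <- enum 'I_n | 0 < mu 0 i])).
    rewrite /= path_min_sorted; last by apply/allP => x /mapP[y _ ->].
    rewrite sorted_map; apply: (@sub_sorted _ ltn) => //.
    rewrite sorted_map; apply: sorted_filter.
      by move=> x y z /=; exact: ltn_trans.
    by rewrite -(@sorted_map _ _ (@nat_of_ord n) ltn) val_enum_ord iota_ltn_sorted.
  by rewrite /= -map_comp.
have kn : all (fun x => x <= n)%N k.
  by apply/allP => x /mapP[i _ ->].
have lk : (last 0 k <= n)%N.
  by move: kn; case/lastP: (k) => // s x; rewrite all_rcons last_rcons => /andP[].
have sk' : path ltn 0%N k'.
  rewrite /k'; case: eqP => // /eqP nl.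
  by rewrite rcons_path sk /= ltn_neqAle nl lk.
have lk' : last 0%N k' = n.
  by rewrite /k'; case: eqP => // _; rewrite last_rcons.
move: sk' lk'; move: k' => s ps ls; apply/andP; split.
  suff H a : path ltn a s -> all (leq 1%N) (pairmap (fun a b => b - a)%N a s).
    exact: H.
  elim: s a {ps ls} => // x s IH a /= /andP[ax ps].
  by rewrite IH// andbT subn_gt0.
rewrite -(big_mkord xpredT (fun i => nth 0 _ i)%N) -(big_nth 0%N xpredT id).
suff H a : path ltn a s ->
    (\sum_(i <- pairmap (fun a b => b - a) a s) i = last a s - a)%N.
  by rewrite H// ls subn0.
elim: s a {ps ls} => [|x s IH] a /=; first by rewrite big_nil subnn.
move=> /andP[ax ps]; rewrite big_cons IH// addnC addnBA ?(ltnW ax)//.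
rewrite subnK//.
elim: s x ps {IH ax} => //= y s IH x /andP[xy ps].
by apply: (leq_trans (ltnW xy)); exact: IH.
Qed.

Definition tau (R : realType) (n : nat) (mu : 'rV[R]_n) : flag_type n :=
  exist (fun I => is_type n I) _ (tau_seq_type mu).

Definition wflag_rel (R : realType) (n : nat) :
    rel (@simplex R n * @orth R n)%type :=
  fun x y => (x.1 == y.1) &&
    (flag_pi (tau (set_val x.1)) x.2 == flag_pi (tau (set_val x.1)) y.2).

Lemma wflag_rel_equiv (R : realType) (n : nat) :
  equiv_class_of (@wflag_rel R n).
Proof.
split=> [x|x y|y x z]; rewrite /wflag_rel.
- by rewrite !eqxx.
- by apply/idP/idP => /andP[/eqP -> /eqP ->]; rewrite !eqxx.
- by move=> /andP[/eqP -> /eqP ->].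
Qed.

Canonical wflag_equiv (R : realType) (n : nat) :=
  EquivRelPack (@wflag_rel_equiv R n).

Definition wflag (R : realType) (n : nat) :=
  quotient_topology {eq_quot @wflag_equiv R n}.

Definition wflag_pi (R : realType) (n : nat) (mu : @simplex R n)
  (U : @orth R n) : wflag R n := \pi_(wflag R n) (mu, U).

Definition weights (R : realType) (n : nat) (p : wflag R n) : 'rV[R]_n :=
  set_val (repr p).1.

Definition top_cell (R : realType) (n : nat) : set (wflag R n) :=
  [set p | forall i, 0 < weights p 0 i].

(* On weights that are all positive, [tau mu = ones n] and this is the
   identification of a pair (mu, W) with a point of the top cell.  The choice
   of representative is irrelevant, as O(1,...,1) is contained in every O(I). *)
Definition wflag_of_full (R : realType) (n : nat) (mu : @simplex R n)
  (W : flag R (ones n)) : wflag R n := wflag_pi mu (repr W).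

(* [f] is C^k on the open set [O]: all partial derivatives of order at most k
   exist and are continuous on [O]. *)
Fixpoint Ck_open (R : realType) (n k : nat) (O : set 'rV[R]_n)
    (f : 'rV[R]_n -> R) : Prop :=
  (forall x, O x -> {for x, continuous f}) /\
  match k with
  | 0%N => True
  | k'.+1 => forall i : 'I_n,
      (forall x, O x -> derivable f x (delta_mx 0 i)) /\
      Ck_open k' O (fun x => 'D_(delta_mx 0 i) f x)
  end.

(* On a set that is not open, C^k means: restriction of a C^k function defined
   on an open neighbourhood of the set. *)
Definition Ck_on (R : realType) (n k : nat) (A : set 'rV[R]_n)
    (f : 'rV[R]_n -> R) : Prop :=
  exists (O : set 'rV[R]_n) (F : 'rV[R]_n -> R),
    [/\ open O, A `<=` O, (forall x, A x -> F x = f x) & Ck_open k O F].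

(* mu_{i -> j}, with 0-based indices: the entries l with i <= l < j are kept. *)
Definition segment_row (R : realType) (n : nat) (mu : 'rV[R]_n) (i j : 'I_n) :
    'rV[R]_n :=
  \row_l (if (i <= l < j)%N then mu 0 l else 0).

(* The tangent vector (alpha, T_U pi . U B) at (mu, pi U) is represented by
   (alpha, B); changing U to U diag(+-1) only changes signs of the entries of
   B and C simultaneously, so the value does not depend on U. *)
Definition metric (R : realType) (n : nat) (f : 'rV[R]_n -> R) (mu : 'rV[R]_n)
    (x y : 'rV[R]_n * 'M[R]_n) : R :=
  \sum_i x.1 0 i * y.1 0 i +
  \sum_(i < n) \sum_(j < n | (i < j)%N)
     f (segment_row mu i j) ^+ 2 * x.2 i j * y.2 i j.

(* One-sided derivatives are used at the end points of an interval [D]. *)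
Definition C1_on (R : realType) (V : normedModType R) (D : set R) (h : R -> V) :
    Prop :=
  exists dh : R -> V,
    (forall t, D t ->
       (s - t)^-1 *: (h s - h t) @[s --> within D t^'] --> dh t) /\
    {within D, continuous dh}.

(* Smooth structure of O(n)/O(I): [flag_pi I] being a submersion, it has smooth
   local sections, and a curve in the quotient is C^1 iff it has C^1 lifts to
   O(n) locally. *)
Definition C1_flag (R : realType) (n : nat) (I : flag_type n) (D : set R)
    (W : R -> flag R I) : Prop :=
  forall t, D t -> exists2 e : R, 0 < e & exists U : R -> @orth R n,
    C1_on (D `&` ball t e) (fun s => set_val (U s) : 'M[R]_n) /\
    (forall s, (D `&` ball t e) s -> W s = flag_pi I (U s)).

Definition piecewise_C1 (R : realType) (n : nat) (a b : R)
    (gamma : R -> wflag R n) : Prop :=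
  {within `[a, b], continuous gamma} /\
  exists (N : nat) (s : nat -> R),
    [/\ s 0%N = a, s N = b, (forall i, (i < N)%N -> s i < s i.+1) &
      forall i, (i < N)%N ->
        (forall t, s i < t < s i.+1 -> top_cell (gamma t)) /\
        exists (mu : R -> @simplex R n) (W : R -> flag R (ones n)),
          [/\ C1_on `[s i, s i.+1] (fun t => set_val (mu t) : 'rV[R]_n),
              C1_flag `[s i, s i.+1] W &
              forall t, s i < t < s i.+1 ->
                gamma t = wflag_of_full (mu t) (W t)]].

(* The derivative of [gamma] at [t], at a point (mu, pi U) of the top cell, is
   (alpha, T_U pi . U B). *)
Definition has_velocity (R : realType) (n : nat) (gamma : R -> wflag R n)
    (t : R) (mu : 'rV[R]_n) (U : 'M[R]_n) (alpha : 'rV[R]_n) (B : 'M[R]_n) :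
    Prop :=
  exists (mut : R -> @simplex R n) (Ut : R -> @orth R n),
    [/\ \forall s \near t, top_cell (gamma s) /\
                           gamma s = wflag_pi (mut s) (Ut s),
        set_val (mut t) = mu /\ set_val (Ut t) = U,
        is_derive t 1 (fun s => set_val (mut s) : 'rV[R]_n) alpha,
        is_derive t 1 (fun s => set_val (Ut s) : 'M[R]_n) (U *m B) &
        skew B].

(* Norm of the derivative for [metric]; 0 where there is no derivative. *)
Definition speed (R : realType) (n : nat) (f : 'rV[R]_n -> R)
    (gamma : R -> wflag R n) (t : R) : R :=
  xget 0 [set v | exists mu U alpha B, has_velocity gamma t mu U alpha B /\
                    v = Num.sqrt (metric f mu (alpha, B) (alpha, B))].

Definition path_length (R : realType) (n : nat) (f : 'rV[R]_n -> R) (a b : R)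
    (gamma : R -> wflag R n) : \bar R :=
  (\int[@lebesgue_measure R]_(t in `[a, b]) (speed f gamma t)%:E)%E.

Definition wflag_dist (R : realType) (n : nat) (f : 'rV[R]_n -> R)
    (p q : wflag R n) : \bar R :=
  ereal_inf [set path_length f 0 1 gamma |
    gamma in [set gamma | [/\ piecewise_C1 0 1 gamma,
                              gamma 0 = p & gamma 1 = q]]].

(* Main.v *)
Require Import Defs.
From HB Require Import structures.
From mathcomp Require Import all_boot all_order all_algebra.
From mathcomp Require Import all_classical all_reals all_analysis.
From mathcomp Require Import measurable_realfun ring lra.
Set Implicit Arguments.
Unset Strict Implicit.
Unset Printing Implicit Defensive.
Import Order.TTheory GRing.Theory Num.Theory.
Import numFieldNormedType.Exports.
Local Open Scope classical_set_scope.
Local Open Scope ring_scope.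
Local Open Scope quotient_scope.

(** The quotient topology and the distance are both governed by finitely many
    real functions on the space of weighted flags.

    Let P_k(U) be the orthogonal projector onto the span of the columns of U
    with index at most k.  Orthogonal matrices in O(tau mu) are those whose
    entries (i, j) and (j, i) vanish as soon as i <= k < j for some k with
    mu_k > 0 ([orth_block_tauP]); hence (mu, U) and (mu, V) represent the same
    weighted flag iff P_k(U) = P_k(V) for every k with mu_k > 0.  Multiplied by
    the cutoff max(0, mu_k - c)^2 with c > 0, the projector P_k becomes a
    continuous function on the whole quotient ([partial_flag]).  For a fixed
    point p, adding up the increments of the weights and of these functions,
    with c half of each positive weight of p, gives a continuous function
    [sep_dist p] that vanishes only at p.  Since the simplex and O(n) are
    compact, convergence to p in the quotient topology amounts to
    [sep_dist p] --> 0 ([cvg_sep_dist]).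

    The distance dominates [sep_dist p].  Along a path with velocity (alpha, B)
    the derivative of a weight is an entry of alpha, and the derivative of P_k
    only involves the entries b_ij with i <= k < j ([dcolproj_skew]).  For these
    the coefficient f(mu_{i -> j}) of the metric sees the weight mu_k; where the
    cutoff is not zero this weight is at least c, and compactness of the cube
    bounds f(mu_{i -> j}) from below.  So each function is C^1 on the pieces of
    the path, with derivative at most C times the speed, and integration gives a
    bound by C times the distance ([observable_lipschitz], [sep_dist_le_dist]).

    Conversely, let q be a point with [sep_dist p q] small, and p = (mu, U).  By
    compactness q has a representative (nu, V) close to (mu, U Q) for some Q in
    O(tau mu) ([sep_dist_nbhs]), and (mu, U Q) represents p too.  The arc
    t |-> V (1 - t A) (1 + t A)^-1, for a suitable small skew A, joins V to U Q
    inside O(n), while the weights follow the segment from nu to mu, pushed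
    slightly into the interior of the simplex.  Since f is bounded on the cube,
    this path is short ([dist_le_path]). *)

(** * Block-diagonal orthogonal matrices *)
Definition psum (I : seq nat) (m : nat) : nat := (\sum_(k < m) nth 0 I k)%N.

Lemma leq_psum I : {homo psum I : m p / (m <= p)%N}.
Proof.
move=> m p mp; rewrite /psum (big_ord_widen p (fun k => nth 0%N I k) mp).
by rewrite big_mkcond leq_sum// => i _; case: ifP.
Qed.

(** The partial sums of a type are the boundaries between the blocks, so that the
    block of an index, [tagnat.sig1], is determined by comparing the index with
    these sums. *)
Lemma psum_leq (I : seq nat) (s : 'I_(\sum_(k < size I) nth 0 I k)%N) m :
  (psum I m <= s)%N = (m <= tagnat.sig1 s)%N.
Proof.
have sE : nat_of_ord s = (psum I (tagnat.sig1 s) + tagnat.sig2 s)%N.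
  rewrite [LHS]tagnat.rect /psum; congr addn.
  by rewrite (big_ord_widen (size I) (fun k => nth 0%N I k)) 1?ltnW.
have lb : (psum I (tagnat.sig1 s) <= s)%N by rewrite [leqRHS]sE leq_addr.
have ub : (s < psum I (tagnat.sig1 s).+1)%N.
  by rewrite [ltnLHS]sE /psum big_ord_recr/= ltn_add2l ltn_ord.
apply/idP/idP => [ms|/(leq_psum I) /leq_trans]; last exact.
rewrite leqNgt; apply/negP => /(leq_psum I) ss.
by have := leq_trans ub (leq_trans ss ms); rewrite ltnn.
Qed.

Lemma orth_block_sep (R : realType) n (I : flag_type n) (Q : 'M[R]_n) m
    (i j : 'I_n) :
  orth_block I Q -> (i < psum (sval I) m <= j)%N -> Q i j = 0 /\ Q j i = 0.
Proof.
move=> [B [_ ->]] {Q}; move: (flag_type_sum I) => e.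
case: I B e => I /= _ B e; case: n / e i j => i j /andP[im mj].
have ij : tagnat.sig1 i != tagnat.sig1 j.
  move: im mj; rewrite ltnNge !psum_leq -ltnNge => im mj.
  by apply/eqP => ijE; move: im; rewrite ijE ltnNge mj.
rewrite castmx_id !mxE/= (negbTE ij) eq_sym (negbTE ij).
by rewrite !mxE.
Qed.

(** The diagonal blocks are again orthogonal because products of block-diagonal
    matrices are computed blockwise. *)
Lemma sep_orth_block (R : realType) n (I : flag_type n) (Q : 'M[R]_n) :
  orth Q ->
  (forall m (i j : 'I_n), (i < psum (sval I) m <= j)%N ->
     Q i j = 0 /\ Q j i = 0) ->
  orth_block I Q.
Proof.
move=> oQ Q0; rewrite /orth_block/=; move: (flag_type_sum I) => e.
case: I Q0 e => I /= _ Q0 e; case: n / e Q Q0 oQ => Q Q0 oQ.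
have Q0' i j : tagnat.sig1 i != tagnat.sig1 j -> Q i j = 0.
  rewrite -val_eqE neq_ltn => /orP[] ij.
    by have [] := Q0 (tagnat.sig1 j) i j _ => //; rewrite ltnNge !psum_leq -ltnNge ij/=.
  by have [] := Q0 (tagnat.sig1 i) j i _ => //; rewrite ltnNge !psum_leq -ltnNge ij/=.
have QE : Q = \mxdiag_i (submxblock Q i i).
  rewrite -[LHS]submxblockK; apply/eq_mxblock => i j.
  have [<-|ij] := eqVneq i j; first by rewrite conform_mx_id.
  by apply/matrixP => a b; rewrite !mxE Q0'// !tagnat.Rank1K.
exists (fun i => submxblock Q i i); rewrite castmx_id; split=> // i.
move: oQ; rewrite /orth/= [X in X^T *m _]QE [X in _^T *m X]QE tr_mxdiag mxdiag_mul.
by rewrite -mxdiagZ => /eq_mxdiagP; apply.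
Qed.

(** Consecutive differences telescope. *)
Lemma psum_pairmap a s m : path ltn a s -> (m < size s)%N ->
  (psum (pairmap (fun a b => b - a) a s) m.+1 + a)%N = nth 0%N s m.
Proof.
rewrite /psum; elim: s a m => // x s IH a [|m] /= /andP[ax ps].
  by rewrite big_ord1/= subnK// ltnW.
rewrite ltnS => ms; rewrite big_ord_recl/= -(IH x m ps ms) addnAC.
by rewrite subnK 1?ltnW// addnC.
Qed.

Definition supp_succ (R : realType) n (mu : 'rV[R]_n) : seq nat :=
  [seq (nat_of_ord i).+1 | i <- enum 'I_n & 0 < mu 0 i].

Lemma path_supp_succ (R : realType) n (mu : 'rV[R]_n) :
  path ltn 0%N (supp_succ mu).
Proof.
rewrite path_min_sorted; last by apply/allP => x /mapP[y _ ->].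
rewrite /supp_succ sorted_map; apply: sorted_filter.
  by move=> x y z /=; exact: ltn_trans.
rewrite (@eq_sorted _ _ (relpre (@nat_of_ord n) ltn))//.
by rewrite -(@sorted_map _ _ (@nat_of_ord n) ltn) val_enum_ord iota_ltn_sorted.
Qed.

Lemma mem_supp_succ (R : realType) n (mu : 'rV[R]_n) (l : 'I_n) :
  (l.+1 \in supp_succ mu) = (0 < mu 0 l).
Proof.
rewrite mem_map; last by move=> i j [] /val_inj.
by rewrite mem_filter mem_enum andbT.
Qed.

(** The increasing list of block boundaries of which [tau_seq mu] is, by
    definition, the list of differences. *)
Definition tau_ends (R : realType) n (mu : 'rV[R]_n) : seq nat :=
  let k := supp_succ mu in if last 0%N k == n then k else rcons k n.

Lemma path_tau_ends (R : realType) n (mu : 'rV[R]_n) : path ltn 0%N (tau_ends mu).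
Proof.
rewrite /tau_ends; case: eqP => [_|/eqP nl]; first exact: path_supp_succ.
rewrite rcons_path path_supp_succ/= ltn_neqAle nl/=.
have : all (fun x => x <= n)%N (supp_succ mu) by apply/allP => x /mapP[i _ ->].
by case/lastP: (supp_succ mu) => // s x; rewrite all_rcons last_rcons => /andP[].
Qed.

Lemma tau_seqE (R : realType) n (mu : 'rV[R]_n) :
  tau_seq mu = pairmap (fun a b => b - a)%N 0%N (tau_ends mu).
Proof. by []. Qed.

(** A block boundary that separates two indices is the successor of an index of
    positive weight: the only other boundaries are 0 and n, which separate
    nothing. *)
Lemma psum_tau_seq (R : realType) n (mu : 'rV[R]_n) (i j : 'I_n) :
  (exists m, (i < psum (tau_seq mu) m <= j)%N) <->
  (exists2 l : 'I_n, (i <= l < j)%N & 0 < mu 0 l).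
Proof.
have nthE m : (m < size (tau_ends mu))%N ->
    psum (tau_seq mu) m.+1 = nth 0%N (tau_ends mu) m.
  by move=> ms; rewrite -[LHS]addn0 tau_seqE psum_pairmap// path_tau_ends.
split=> [[m]|[l ilj mul]]; last first.
  have lk : l.+1 \in tau_ends mu.
    rewrite /tau_ends/=; case: ifP => _; rewrite ?mem_rcons ?inE mem_supp_succ//.
    by rewrite mul orbT.
  exists (index l.+1 (tau_ends mu)).+1.
  by rewrite nthE ?index_mem// nth_index// ltnS.
wlog ms : m / (m <= size (tau_ends mu))%N.
  have [ms|/ltnW ms] := leqP m (size (tau_ends mu)); first by apply.
  have -> : psum (tau_seq mu) m = psum (tau_seq mu) (size (tau_ends mu)).
    rewrite /psum -(subnKC ms) big_split_ord/= [X in (_ + X)%N]big1 ?addn0// => k _.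
    by rewrite nth_default// tau_seqE size_pairmap leq_addr.
  by apply; exact: leqnn.
case: m ms => [|m] ms; first by rewrite /psum big_ord0.
rewrite nthE// => /andP[il lj].
have : nth 0%N (tau_ends mu) m \in tau_ends mu by exact: mem_nth.
move: (nth _ _ _) il lj => l il lj lin.
have : l \in supp_succ mu.
  move: lin; rewrite /tau_ends/=; case: ifP => // _.
  rewrite mem_rcons inE => /orP[/eqP ln|//].
  by move: lj; rewrite ln leqNgt ltn_ord.
case/mapP => k; rewrite mem_filter => /andP[kmu _] lE.
by exists k => //; rewrite -ltnS -lE il lj.
Qed.

(** In this form the block structure can be compared with the metric: for
    nonnegative mu, the row [segment_row mu i j] is nonzero exactly when some l
    with i <= l < j has positive weight. *)
Lemma orth_block_tauP (R : realType) n (mu : 'rV[R]_n) (Q : 'M[R]_n) :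
  orth_block (tau mu) Q <-> orth Q /\
   (forall i j l : 'I_n, (i <= l < j)%N -> 0 < mu 0 l -> Q i j = 0 /\ Q j i = 0).
Proof.
split=> [oQ|[oQ Q0]].
  split; first exact: orth_block_orth oQ.
  move=> i j l ilj mul.
  have [m im] : exists m, (i < psum (tau_seq mu) m <= j)%N.
    by apply/psum_tau_seq; exists l.
  exact: orth_block_sep oQ im.
apply: sep_orth_block oQ _ => m i j im.
have [l ilj mul] : exists2 l : 'I_n, (i <= l < j)%N & 0 < mu 0 l.
  by apply/psum_tau_seq; exists m.
exact: Q0 ilj mul.
Qed.

Lemma orth_block_ones_diag (R : realType) n (Q : 'M[R]_n) (i j : 'I_n) :
  orth_block (ones n) Q -> i != j -> Q i j = 0.
Proof.
move=> oQ; have p1 m : (m <= n)%N -> psum (nseq n 1%N) m = m.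
  move=> mn; rewrite /psum (eq_bigr (fun=> 1%N)) ?sum1_card ?card_ord// => k _.
  by rewrite nth_nseq (leq_trans _ mn).
rewrite -val_eqE neq_ltn => /orP[] ij.
  have [] := @orth_block_sep _ _ _ _ j i j oQ => //.
  by rewrite p1 ?leqnn ?andbT//; exact/ltnW.
have [] := @orth_block_sep _ _ _ _ i j i oQ => //.
by rewrite p1 ?leqnn ?andbT//; exact/ltnW.
Qed.

(** * Limits and derivatives of finite sums *)
Lemma cvg_sum (K : numFieldType) (V : normedModType K) (T I : Type) (F : set_system T)
    {FF : Filter F} (r : seq I) (P : pred I) (f : I -> T -> V) (l : I -> V) :
  (forall i, P i -> f i x @[x --> F] --> l i) ->
  \sum_(i <- r | P i) f i x @[x --> F] --> \sum_(i <- r | P i) l i.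
Proof.
move=> fl; elim: r => [|i r IH].
  by under eq_cvg do rewrite big_nil; rewrite big_nil; exact: cvg_cst.
under eq_cvg do rewrite big_cons; rewrite big_cons.
by case: ifP => // Pi; apply: cvgD => //; exact: fl.
Qed.

Lemma continuous_bigsum (K : numFieldType) (V : normedModType K) (T : topologicalType)
    (I : Type) (r : seq I) (P : pred I) (f : I -> T -> V) :
  (forall i, P i -> continuous (f i)) -> continuous (fun x => \sum_(i <- r | P i) f i x).
Proof. by move=> fc x; apply: cvg_sum => i Pi; exact: fc. Qed.

Lemma continuous_absB (K : numFieldType) (T : topologicalType) (f : T -> K) (c : K) :
  continuous f -> continuous (fun x => `|f x - c|).
Proof. by move=> fc x; apply: cvg_norm; apply: cvgB; [exact: fc|exact: cvg_cst]. Qed.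

Lemma is_derive_bigsum (K : numFieldType) (V W : normedModType K) (I : Type)
    (r : seq I) (P : pred I) (f : I -> V -> W) (df : I -> W) (x v : V) :
  (forall i, P i -> is_derive x v (f i) (df i)) ->
  is_derive x v (fun y => \sum_(i <- r | P i) f i y) (\sum_(i <- r | P i) df i).
Proof.
move=> fdf; rewrite -(_ : \sum_(i <- r | P i) f i = fun y => _); last first.
  by apply/funext => y; rewrite fct_sumE.
apply: (big_ind2 (fun g dg => is_derive x v g dg)) => //.
  exact: is_derive_cst.
by move=> g dg h dh gd hd; exact: is_deriveD.
Qed.

(** * Column projectors and equality of weighted flags *)
Section colproj.
Context {R : realType} {n : nat}.
Implicit Types (S : pred 'I_n) (U V Q : 'M[R]_n) (mu nu : @simplex R n).

(** For an orthogonal U, the entry (a, b) of the orthogonal projector onto the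
    span of the columns of U with index in S. *)
Definition colproj S U (a b : 'I_n) : R := \sum_(l | S l) U a l * U b l.

Let D S : 'M[R]_n := diag_mx (\row_l (S l)%:R).

Let projE S U a b : colproj S U a b = (U *m D S *m U^T) a b.
Proof.
rewrite !mxE /colproj big_mkcond/=; apply: eq_bigr => l _.
by rewrite mul_mx_diag !mxE; case: (S l); rewrite ?mulr1// mulr0 mul0r.
Qed.

(** Such a Q commutes with the diagonal matrix of the indicator of S: it mixes
    the columns in S among themselves, and the others among themselves. *)
Lemma colproj_mulmxr S U Q a b : orth Q ->
  (forall i j, S i != S j -> Q i j = 0) -> colproj S (U *m Q) a b = colproj S U a b.
Proof.
move=> /mulmx1C oQ Q0; rewrite !projE trmx_mul.
suff QD : Q *m D S = D S *m Q.
  by rewrite -!mulmxA (mulmxA Q) QD -(mulmxA (D S)) (mulmxA Q) oQ mul1mx.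
apply/matrixP => i j; rewrite mul_mx_diag mul_diag_mx !mxE mulrC.
by have [->//|/Q0 ->] := eqVneq (S i) (S j); rewrite !mulr0.
Qed.

(** Conversely, with D the diagonal matrix of the indicator of S, the identity
    U D U^T = V D V^T says that U^T V commutes with D. *)
Lemma colproj_eq_sep S U V : orth U -> orth V ->
  (forall a b, colproj S U a b = colproj S V a b) ->
  forall i j, S i != S j -> (U^T *m V) i j = 0.
Proof.
move=> oU oV UV i j Sij.
have UVD : U *m D S *m U^T = V *m D S *m V^T.
  by apply/matrixP => a b; rewrite -!projE.
have : D S *m (U^T *m V) = (U^T *m V) *m D S.
  transitivity (U^T *m (U *m D S *m U^T) *m V).
    by rewrite !mulmxA (oU : _ = _) mul1mx.
  by rewrite UVD !mulmxA -(mulmxA _ V^T) (oV : _ = _) mulmx1.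
move/matrixP/(_ i j); rewrite mul_mx_diag mul_diag_mx !mxE.
by move: Sij; case: (S i); case: (S j) => //= _; rewrite !(mul0r, mulr0, mul1r, mulr1).
Qed.

Lemma wflag_pi_eq mu nu (U V : @orth R n) :
  wflag_pi mu U = wflag_pi nu V <->
  mu = nu /\ orth_block (tau (set_val mu)) ((set_val U)^T *m set_val V).
Proof.
rewrite /wflag_pi; split.
  move=> /eqquotP; rewrite /= /wflag_rel/= => /andP[/eqP -> /eqP/eqquotP].
  move=> /asboolP[Q oQ ->]; split=> //.
  by rewrite mulmxA (set_valP U : _ = _) mul1mx.
move=> [<- oQ]; apply/eqquotP; rewrite /= /wflag_rel/= eqxx/=; apply/eqP/eqquotP.
apply/asboolP; exists ((set_val U)^T *m set_val V) => //.
by rewrite mulmxA (mulmx1C (set_valP U)) mul1mx.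
Qed.

Lemma weights_pi mu (U : @orth R n) : weights (wflag_pi mu U) = set_val mu.
Proof.
rewrite /weights; case E : (repr _) => [nu V] /=.
have : wflag_pi mu U = wflag_pi nu V by rewrite -[LHS]reprK E.
by move=> /wflag_pi_eq[->].
Qed.

Lemma wflag_repr (q : wflag R n) : wflag_pi (repr q).1 (repr q).2 = q.
Proof. by rewrite /wflag_pi -surjective_pairing reprK. Qed.

(** O(1, ..., 1) consists of diagonal matrices, which lie in every O(I), so the
    representative picked by [repr] is harmless. *)
Lemma wflag_of_full_pi mu (U : @orth R n) :
  wflag_of_full mu (flag_pi (ones n) U) = wflag_pi mu U.
Proof.
apply/wflag_pi_eq; split=> //; apply/orth_block_tauP.
have : flag_pi (ones n) U = flag_pi (ones n) (repr (flag_pi (ones n) U)).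
  by rewrite /flag_pi reprK.
move: (repr _) => V /eqquotP /asboolP[Q oQ ->].
have oE : (set_val U *m Q)^T *m set_val U = Q^T.
  by rewrite trmx_mul -mulmxA (set_valP U : _ = _) mulmx1.
rewrite oE; split; first exact: orth_block_orth (orth_blockT oQ).
move=> i j l /andP[il lj] _.
have ij : i != j by rewrite -val_eqE neq_ltn (leq_ltn_trans il lj).
by rewrite !mxE !(orth_block_ones_diag oQ) // eq_sym.
Qed.

End colproj.

(** * Functions that separate weighted flags *)
Section obs.
Context {R : realType} {n : nat}.
Implicit Types (mu nu : @simplex R n) (p q : wflag R n) (c x y : R).

Definition cutoff c x : R := Num.max 0 (x - c) ^+ 2.

Lemma cutoff_le0 c x : x <= c -> cutoff c x = 0.
Proof. by move=> xc; rewrite /cutoff max_l ?expr0n// subr_le0. Qed.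

Lemma cutoff_gt0 c x : c < x -> 0 < cutoff c x.
Proof. by move=> xc; rewrite /cutoff max_r ?exprn_gt0 ?subr_gt0// subr_ge0 ltW. Qed.

(** The projector onto the span of the first columns, up to index k, is determined
    by the weighted flag only if the k-th weight is positive.  The cutoff makes it
    a function on the quotient, without destroying differentiability along
    paths. *)
Definition partial_flag c (k a b : 'I_n) q : R :=
  cutoff c (weights q 0 k) * colproj (fun l => (l <= k)%N) (set_val (repr q).2) a b.

Lemma partial_flag_pi c k a b mu (U : @orth R n) : 0 <= c ->
  partial_flag c k a b (wflag_pi mu U) =
  cutoff c (set_val mu 0 k) * colproj (fun l => (l <= k)%N) (set_val U) a b.
Proof.
move=> c0; rewrite /partial_flag weights_pi.
have [kc|ck] := leP (set_val mu 0 k) c; first by rewrite cutoff_le0// !mul0r.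
congr (_ * _); case E : (repr _) => [nu V] /=.
have : wflag_pi mu U = wflag_pi nu V by rewrite -[LHS]reprK E.
move=> /wflag_pi_eq[_ /orth_block_tauP[oQ Q0]].
rewrite -[set_val V]mul1mx -(mulmx1C (set_valP U)) -mulmxA colproj_mulmxr// => i j.
have mk := le_lt_trans c0 ck.
have [ik|ki] := leqP i k; have [jk|kj] := leqP j k => // _.
  by have [] := Q0 i j k; rewrite ?ik.
by have [] := Q0 j i k; rewrite ?jk.
Qed.

(** The thresholds [weights p 0 k / 2] lie strictly between 0 and the weights of p:
    positive, so that [partial_flag] is well defined and the metric is bounded
    below where the cutoff is nonzero, and small enough for the cutoff not to
    vanish at p. *)
Definition sep_dist p q : R :=
  \sum_i `|weights q 0 i - weights p 0 i| +
  \sum_(k | 0 < weights p 0 k) \sum_a \sum_b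
    `|partial_flag (weights p 0 k / 2) k a b q - partial_flag (weights p 0 k / 2) k a b p|.

Lemma sep_dist_ge0 p q : 0 <= sep_dist p q.
Proof.
apply: addr_ge0; first by apply: sumr_ge0 => i _; exact: normr_ge0.
by do 3 (apply: sumr_ge0 => ? _); exact: normr_ge0.
Qed.

Lemma sep_dist_refl p : sep_dist p p = 0.
Proof.
rewrite /sep_dist !big1 ?addr0// => i _; rewrite ?subrr ?normr0//.
by do 2 (rewrite big1// => ? _); rewrite subrr normr0.
Qed.

(** Equality of the projectors for all k of positive weight forces, by
    [colproj_eq_sep], the zeros that characterize O(tau mu). *)
Lemma sep_dist_eq0 p q : sep_dist p q = 0 -> p = q.
Proof.
rewrite -(wflag_repr p) -(wflag_repr q).
move: (repr p) (repr q) => [mu U] [nu V] /= /eqP.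
rewrite paddr_eq0; last 2 first.
- by apply: sumr_ge0 => i _; exact: normr_ge0.
- by do 3 (apply: sumr_ge0 => ? _); exact: normr_ge0.
rewrite !psumr_eq0; last 2 first.
- by move=> *; do 2 (apply: sumr_ge0 => ? _); exact: normr_ge0.
- by move=> *; exact: normr_ge0.
rewrite !weights_pi => /andP[/allP wE /allP pE].
have mn : mu = nu.
  apply/val_inj/rowP => i; have := wE i; rewrite mem_index_enum => /(_ isT).
  by rewrite normr_eq0 subr_eq0 => /eqP ->.
rewrite -mn in pE *; apply/wflag_pi_eq; split=> //; apply/orth_block_tauP.
split.
  rewrite /orth/= trmx_mul trmxK -mulmxA (mulmxA _ _ (set_val V)).
  by rewrite (mulmx1C (set_valP U)) mul1mx (set_valP V : _ = _).
move=> i j k /andP[ik kj] mk.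
have projE a b : colproj (fun l => (l <= k)%N) (set_val U) a b =
    colproj (fun l => (l <= k)%N) (set_val V) a b.
  have := pE k; rewrite mem_index_enum mk => /(_ isT)/=.
  rewrite psumr_eq0; last by move=> *; apply: sumr_ge0 => ? _; exact: normr_ge0.
  move=> /allP/(_ a); rewrite mem_index_enum => /(_ isT)/=.
  rewrite psumr_eq0; last by move=> *; exact: normr_ge0.
  move=> /allP/(_ b); rewrite mem_index_enum => /(_ isT)/=.
  rewrite normr_eq0 subr_eq0 !partial_flag_pi ?divr_ge0 ?ltW//.
  move=> /eqP /mulfI ->//; rewrite gt_eqF// cutoff_gt0//.
  by rewrite ltr_pdivrMr// ltr_pMr// ltr1n.
have sepE := @colproj_eq_sep _ _ (fun l => (l <= k)%N) _ _ (set_valP U) (set_valP V) projE.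
split; apply: sepE.
  by rewrite ik leqNgt kj.
by rewrite ik leqNgt kj.
Qed.

Lemma simplex_coord_continuous (i : 'I_n) :
  continuous (fun z : (@simplex R n * @orth R n)%type =>
    (set_val z.1 : 'rV[R]_n) 0 i).
Proof.
move=> x; apply: (@continuous_comp _ _ _ fst
  (fun mu : @simplex R n => (set_val mu : 'rV[R]_n) 0 i)).
  exact: cvg_fst.
apply: (@continuous_comp _ _ _ set_val (fun M : 'rV[R]_n => M 0 i)).
  exact: initial_continuous.
exact: coord_continuous.
Qed.

Lemma orth_snd_continuous :
  continuous (fun z : (@simplex R n * @orth R n)%type => (set_val z.2 : 'M[R]_n)).
Proof.
move=> x; apply: (@continuous_comp _ _ _ snd (fun U : @orth R n => (set_val U : 'M[R]_n))).
  exact: cvg_snd.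
exact: initial_continuous.
Qed.

Lemma weights_continuous (i : 'I_n) : continuous (fun q => weights q 0 i).
Proof.
apply/quotient_continuous.
rewrite (_ : _ \o _ = fun z : (@simplex R n * @orth R n)%type => (set_val z.1 : 'rV[R]_n) 0 i).
  exact: simplex_coord_continuous.
by apply/funext => -[mu U] /=; rewrite -/(wflag_pi mu U) weights_pi.
Qed.

Lemma pos_part_continuous c : continuous (fun x : R => Num.max 0 (x - c)).
Proof.
move=> x; apply: (@continuous_max _ _ (fun=> 0) (fun x : R => x - c)).
  exact: cvg_cst.
by apply: cvgB; [exact: cvg_id|exact: cvg_cst].
Qed.

Lemma cutoff_continuous c : continuous (cutoff c).
Proof. by move=> x; apply: cvgM; exact: pos_part_continuous. Qed.

Lemma colproj_continuous (S : pred 'I_n) a b :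
  continuous (fun U : 'M[R]_n => colproj S U a b).
Proof.
apply: continuous_bigsum => l _ U.
exact: (cvgM (@coord_continuous _ _ _ a l U) (@coord_continuous _ _ _ b l U)).
Qed.

Lemma partial_flag_continuous c k a b : 0 <= c -> continuous (partial_flag c k a b).
Proof.
move=> c0; apply/quotient_continuous.
rewrite (_ : _ \o _ = fun z : (@simplex R n * @orth R n)%type =>
    cutoff c ((set_val z.1 : 'rV[R]_n) 0 k) *
       colproj (fun l => (l <= k)%N) (set_val z.2) a b); last first.
  by apply/funext => -[mu U] /=; rewrite -/(wflag_pi mu U) partial_flag_pi.
move=> x; apply: cvgM.
  exact: (continuous_comp (@simplex_coord_continuous k x) (@cutoff_continuous c _)).
exact: (continuous_comp (@orth_snd_continuous x) (@colproj_continuous _ a b _)).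
Qed.

Lemma sep_dist_continuous p : continuous (sep_dist p).
Proof.
have s1 : continuous (fun q => \sum_i `|weights q 0 i - weights p 0 i|).
  by apply: continuous_bigsum => i _; apply: continuous_absB; exact: weights_continuous.
have s2 : continuous (fun q => \sum_(k | 0 < weights p 0 k) \sum_a \sum_b
    `|partial_flag (weights p 0 k / 2) k a b q - partial_flag (weights p 0 k / 2) k a b p|).
  do 3 (apply: continuous_bigsum => ? ?); apply: continuous_absB.
  by apply: partial_flag_continuous; rewrite divr_ge0// ltW.
by move=> q; exact: (cvgD (s1 q) (s2 q)).
Qed.

End obs.

(** * Compactness *)
Lemma compact_set_type (T : topologicalType) (A : set T) :
  compact A -> compact [set: A].
Proof.
move=> cA F FF _.
have [|a [Aa clFa]] := cA (fmap set_val F) (fmap_proper_filter _ _).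
  by rewrite /fmap/=; apply: filterE => x; exact: set_valP.
exists (SigSub (mem_set Aa)); split=> // B C FB; case=> W [[G oG GW] Wa WC].
have [||y [[x Bx xy] Gy]] := clFa (set_val @` B) G.
- by rewrite /fmap/=; apply: filterS FB => x Bx; exists x.
- by apply: open_nbhs_nbhs; split=> //; move: Wa; rewrite -GW.
by exists x; split=> //; apply: WC; rewrite -GW/= xy.
Qed.

Lemma cvg_mx (K : numFieldType) (T : Type) (F : set_system T) {FF : Filter F} m n
    (f : T -> 'M[K]_(m, n)) (M : 'M[K]_(m, n)) :
  (forall i j, f x i j @[x --> F] --> M i j) -> f @ F --> M.
Proof.
move=> fM P [Q QM QP]; rewrite nbhs_simpl/=.
have : F [set x | forall i j, Q i j (f x i j)].
  apply: filter_forall => i; apply: filter_forall => j; apply: (fM i j).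
  exact: QM.
by apply: filterS => x Qx; exact: QP.
Qed.

Section compactness.
Context {R : realType} {n : nat}.

Lemma orth_entry_le1 (U : 'M[R]_n) i j : orth U -> `|U i j| <= 1.
Proof.
move=> /matrixP/(_ j j); rewrite !mxE eqxx/= mulr1n => UE.
have : (U i j) ^+ 2 <= 1.
  rewrite -UE (bigD1 i)//= mxE expr2 lerDl sumr_ge0// => k _.
  by rewrite !mxE -expr2 sqr_ge0.
by rewrite -(@real_normK _ (U i j)) ?num_real ?expr_le1.
Qed.

Lemma compact_orth : compact (@orth R n).
Proof.
(* O(n) is a closed subset of the cube of matrices with entries in [-1, 1], the
   image of a cube of row vectors under [vec_mx] *)
have cK : compact [set v : 'rV[R]_(n * n) | forall i, `[-1, 1]%classic (v ord0 i)].
  by apply: (@rV_compact R _ (fun=> `[(-1 : R), 1]%classic)) => i; exact: segment_compact.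
have cv : continuous (@vec_mx R n n).
  move=> v; apply: (@cvg_mx _ _ (nbhs v) (nbhs_filter v)) => i j.
  rewrite mxE; under eq_cvg do rewrite mxE.
  exact: (@coord_continuous _ _ _ 0 (mxvec_index i j) v).
apply: subclosed_compact (continuous_compact (continuous_subspaceT cv) cK) _.
  (* closedness: U^T U = 1 is a conjunction of polynomial equations *)
  rewrite (_ : @orth R n = \bigcap_(ij in [set: 'I_n * 'I_n])
      ((fun U : 'M[R]_n => \sum_l U l ij.1 * U l ij.2) @^-1`
        [set (1%:M : 'M[R]_n) ij.1 ij.2])).
    apply: closed_bigI => -[i j] _ /=; apply: preimage_closed; last exact: closed_eq.
    move=> U _; move: U; apply: continuous_bigsum => l _ U.
    exact: (cvgM (@coord_continuous _ _ _ l i U) (@coord_continuous _ _ _ l j U)).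
  apply/seteqP; split=> [U oU [i j] _ /=|U oU].
    rewrite -(oU : _ = _) mxE; apply: eq_bigr => l _; by rewrite mxE.
  apply/matrixP => i j; rewrite -(oU (i, j) I)/= mxE.
  by apply: eq_bigr => l _; rewrite mxE.
move=> U oU; exists (mxvec U); last by rewrite mxvecK.
move=> k /=; case/mxvec_indexP: k => i j; rewrite mxvecE in_itv/=.
by rewrite -ler_norml orth_entry_le1.
Qed.

Lemma compact_cube : compact (@cube R n).
Proof.
rewrite (_ : @cube R n = [set v | forall i, `[0, 1]%classic (v ord0 i)]).
  by apply: (@rV_compact R _ (fun=> `[(0 : R), 1]%classic)) => i; exact: segment_compact.
by apply/seteqP; split=> v vc i; have := vc i; rewrite /= in_itv.
Qed.

Lemma compact_simplex : compact (@simplex R n).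
Proof.
rewrite (_ : @simplex R n =
  @cube R n `&` (fun mu : 'rV[R]_n => \sum_i mu 0 i) @^-1` [set 1])//.
apply: compact_closedI; first exact: compact_cube.
apply: preimage_closed; last exact: closed_eq.
move=> U _; move: U; apply: continuous_bigsum => l _ U.
exact: coord_continuous.
Qed.

Implicit Types (p q : wflag R n).

(** The complement of A is compact and does not meet the fibre of p, where alone
    [sep_dist p] vanishes; so [sep_dist p] has a positive minimum on it. *)
Lemma sep_dist_nbhs p (A : set (@simplex R n * @orth R n)%type) : open A ->
  (forall mu U, wflag_pi mu U = p -> A (mu, U)) ->
  exists2 e : R, 0 < e & forall mu U, sep_dist p (wflag_pi mu U) < e -> A (mu, U).
Proof.
move=> oA pA.
have cK : compact (~` A).
  apply: (@subclosed_compact _ _ [set: (@simplex R n * @orth R n)%type]) => //.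
    exact: open_closedC.
  rewrite -setXTT; apply: compact_setX; apply: compact_set_type.
    exact: compact_simplex.
  exact: compact_orth.
have [K0|/set0P K0] := eqVneq (~` A) set0.
  by exists 1 => // mu U _; apply: contrapT => /= nA; have : set0 (mu, U) by rewrite -K0.
have cs : continuous (sep_dist p \o \pi_(wflag R n)).
  by apply/quotient_continuous; exact: sep_dist_continuous.
have [[nu V] KV minV] := compact_EVT_min K0 cK (continuous_subspaceT cs).
exists (sep_dist p (wflag_pi nu V)).
  rewrite lt_neqAle sep_dist_ge0 andbT eq_sym.
  apply/eqP => /sep_dist_eq0/esym/pA.
  by rewrite inE in KV.
move=> mu U sU; apply: contrapT => nA.
by have := minV (mu, U); rewrite inE => /(_ nA)/=; rewrite leNgt sU.
Qed.

Lemma cvg_sep_dist (x : nat -> wflag R n) p :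
  (x m @[m --> \oo] --> p) <-> (sep_dist p (x m) @[m --> \oo] --> 0).
Proof.
split=> [xp|sp].
  rewrite -(sep_dist_refl p).
  exact: (cvg_comp _ _ xp (@sep_dist_continuous _ _ p p)).
move=> B; rewrite nbhsE => -[G [oG Gp] GB].
have piG mu U : wflag_pi mu U = p -> (\pi_(wflag R n) @^-1` G) (mu, U).
  by move=> piE; rewrite /= -/(wflag_pi mu U) piE.
have [e e0 eG] := @sep_dist_nbhs p _ (oG : open (\pi_(wflag R n) @^-1` G)) piG.
move/cvgrPdist_lt : sp => /(_ e e0); rewrite /= !nbhs_simpl/=; apply: filterS => m.
rewrite sub0r normrN ger0_norm ?sep_dist_ge0// => xe; apply: GB.
by rewrite -[X in G X]wflag_repr; apply: eG; rewrite wflag_repr.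
Qed.

End compactness.

(** * Increments and lower integrals *)
Section incr.
Context {R : realType}.
Implicit Types (h dh g : R -> R) (a b t : R).
Local Notation mu := (@lebesgue_measure R).

(** The integral of a nonnegative function is a supremum over the simple functions
    below it, hence monotone among arbitrary functions.  The speed of a path is a
    pointwise choice, which is compared with measurable functions in this way. *)
Lemma ge0_le_integral_nonmeasurable (D : set R) (f1 f2 : R -> \bar R) :
  (forall x, D x -> (0 <= f1 x)%E) -> (forall x, D x -> (f1 x <= f2 x)%E) ->
  (\int[mu]_(x in D) f1 x <= \int[mu]_(x in D) f2 x)%E.
Proof.
move=> f0 f12; rewrite !ge0_integralE//; last first.
  by move=> x Dx; exact: le_trans (f0 x Dx) (f12 x Dx).
apply: ereal_sup_le => _ [k kf <-]; exists k => // x.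
apply: (le_trans (kf x)); rewrite /patch; case: ifPn => // /set_mem.
exact: f12.
Qed.

(** The fundamental theorem of calculus applies on compact subintervals; the
    continuity of h at the end points does the rest. *)
Lemma increment_le_integral h dh a b : a < b ->
  {within `[a, b], continuous h} ->
  (forall t, a < t < b -> is_derive t 1 h (dh t)) ->
  (forall t, a < t < b -> {for t, continuous dh}) ->
  (`|h b - h a|%:E <= \int[mu]_(t in `]a, b[) `|dh t|%:E)%E.
Proof.
move=> ab /(continuous_within_itvP _ ab)[hc ha hb] hd dhc.
have mdh : measurable_fun `]a, b[ dh.
  apply: open_continuous_measurable_fun; first exact: interval_open.
  by move=> t; rewrite inE/= in_itv/=; exact: dhc.
have mabs : measurable_fun `]a, b[ (fun t => `|dh t|%:E).
  by apply/measurable_EFinP; exact: measurableT_comp.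
have inner c d : a < c -> c < d -> d < b ->
    (`|h d - h c|%:E <= \int[mu]_(t in `]a, b[) `|dh t|%:E)%E.
  move=> ac cd db.
  have cdab t : c <= t <= d -> a < t < b.
    by move=> /andP[ct td]; rewrite (lt_le_trans ac)//= (le_lt_trans td).
  have sub : `[c, d] `<=` `]a, b[.
    by move=> t /=; rewrite !in_itv/=; exact: cdab.
  have hcont t : c <= t <= d -> {for t, continuous h}.
    by move=> /cdab ctd; apply: hc; rewrite in_itv.
  have dhw : {within `[c, d], continuous dh}.
    apply: continuous_in_subspaceT => t; rewrite inE/= in_itv/= => /cdab.
    exact: dhc.
  have hLR : derivable_oo_LRcontinuous h c d.
    split.
    - move=> t /[!in_itv]/= /andP[ct td]; apply: ex_derive.
      by apply: hd; apply: cdab; rewrite !ltW.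
    - by apply: cvg_at_right_filter; apply: hcont; rewrite lexx ltW.
    - by apply: cvg_at_left_filter; apply: hcont; rewrite lexx ltW.
  have hdh : {in `]c, d[, derive1 h =1 dh}.
    move=> t /[!in_itv]/= /andP[ct td]; rewrite derive1E; apply: derive_val.
    by apply: hd; apply: cdab; rewrite !ltW.
  rewrite -abse_EFin EFinB -(continuous_FTC2 cd dhw hLR hdh).
  have mcd : measurable_fun `[c, d] (EFin \o dh).
    by apply/measurable_EFinP; exact: measurable_funS mdh.
  have := @le_abse_integral _ _ _ mu `[c, d]%classic (EFin \o dh) (measurable_itv _) mcd.
  move=> /le_trans; apply.
  exact: ge0_subset_integral.
set I := (\int[mu]_(t in _) _)%E in inner *.
have I0 : (0 <= I)%E by exact: integral_ge0.
move: I I0 inner => [r||] //= _ inner; last by rewrite leey.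
rewrite lee_fin; apply/ler_addgt0Pr => e e0.
near a^'+ => c; near b^'- => d.
have ac : a < c by [].
have db : d < b by [].
have cd : c < d.
  by near: d; apply: nbhs_left_gt; near: c; exact: nbhs_right_lt.
have := inner c d ac cd db; rewrite lee_fin => hdc.
have hac : `|h a - h c| < e / 2.
  by near: c; move/cvgrPdist_lt : ha; apply; rewrite divr_gt0.
have hbd : `|h b - h d| < e / 2.
  by near: d; move/cvgrPdist_lt : hb; apply; rewrite divr_gt0.
rewrite (_ : h b - h a = (h b - h d) + (h d - h c) + (- (h a - h c))).
  have := ler_normD (h b - h d + (h d - h c)) (- (h a - h c)).
  have := ler_normD (h b - h d) (h d - h c).
  by rewrite normrN; lra.
by ring.
Unshelve. all: by end_near. Qed.

(** The functions |dh| / C restricted to the open pieces are measurable, and at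
    each point at most one of them is nonzero; so their sum is a measurable
    minorant of g, whose integral is the sum of the integrals over the pieces. *)
Lemma piecewise_increment_le_integral h dh g (s : nat -> R) N C : 0 < C ->
  (forall t, 0 <= g t) ->
  (forall i, (i < N)%N -> s i < s i.+1) ->
  {within `[s 0%N, s N], continuous h} ->
  (forall i t, (i < N)%N -> s i < t < s i.+1 ->
     [/\ is_derive t 1 h (dh t), {for t, continuous dh} & `|dh t| <= C * g t]) ->
  (`|h (s N) - h (s 0%N)|%:E <= C%:E * \int[mu]_(t in `[s 0%N, s N]) (g t)%:E)%E.
Proof.
move=> C0 g0 ss hc hd.
have smono i j : (i <= j <= N)%N -> s i <= s j.
  elim: j => [|j IH]; first by rewrite leqn0 => /andP[/eqP ->].
  rewrite leq_eqVlt => /andP[/orP[/eqP ->//|ij] jN].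
  by rewrite (le_trans (IH _) (ltW (ss _ jN)))// -ltnS ij ltnW.
have subI i : (i < N)%N -> `]s i, s i.+1[ `<=` `[s 0%N, s N].
  move=> iN t /=; rewrite !in_itv/= => /andP[it ti].
  apply/andP; split.
    by apply: (le_trans _ (ltW it)); apply: smono; rewrite leq0n ltnW.
  by apply: (le_trans (ltW ti)); apply: smono; rewrite iN leqnn.
(* the part of the minorant of [g] carried by the i-th piece *)
pose m i : R -> \bar R := (fun t => (C^-1 * `|dh t|)%:E) \_ `]s i, s i.+1[.
have mI i : (i < N)%N -> measurable_fun `]s i, s i.+1[ (fun t => (`|dh t|)%:E).
  move=> iN; apply/measurable_EFinP; apply: measurableT_comp => //.
  apply: open_continuous_measurable_fun; first exact: interval_open.
  by move=> t; rewrite inE/= in_itv/= => /hd -/(_ iN)[].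
have m0 i t : (0 <= m i t)%E.
  by rewrite /m /patch; case: ifP => // _; rewrite lee_fin mulr_ge0// invr_ge0 ltW.
have mm i : (i < N)%N -> measurable_fun `[s 0%N, s N] (m i).
  move=> iN; apply/measurable_restrict => //; rewrite (setIidr (subI _ iN)).
  exact: (measurable_funeM C^-1%:E (mI i iN)).
have im (i : 'I_N) : (`|h (s i.+1) - h (s i)|%:E <=
    C%:E * \int[mu]_(t in `[s 0%N, s N]) m i t)%E.
  rewrite -integral_mkcondr (setIidr (subI _ (ltn_ord i))).
  under eq_integral do rewrite EFinM.
  rewrite ge0_integralZl//; last by rewrite lee_fin invr_ge0 ltW.
    rewrite muleA -EFinM mulfV ?gt_eqF// mul1e.
    apply: increment_le_integral.
    - exact: ss.
    - apply: continuous_subspaceW hc => t /=; rewrite !in_itv/= => /andP[it ti].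
      apply/andP; split.
        by apply: (le_trans _ it); apply: smono; rewrite leq0n ltnW.
      by apply: (le_trans ti); apply: smono; rewrite leqnn andbT.
    - by move=> t /hd -/(_ (ltn_ord i))[].
    - by move=> t /hd -/(_ (ltn_ord i))[].
  exact: mI.
apply: (@le_trans _ _ (\sum_(i < N) `|h (s i.+1) - h (s i)|%:E)%E).
  rewrite sumEFin lee_fin -(telescope_sumr (fun i => h (s i)))// big_mkord.
  exact: ler_norm_sum.
apply: (le_trans (lee_sum _ (fun i _ => im i))).
rewrite -ge0_sume_distrr; last by move=> i _; exact: integral_ge0.
rewrite lee_pmul2l// -ge0_integral_sum//; last by move=> i; exact: mm.
apply: ge0_le_integral_nonmeasurable => t _; first exact: sume_ge0.
have [[i it]|noi] := pselect (exists i : 'I_N, t \in `]s i, s i.+1[); last first.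
  rewrite big1 ?lee_fin// => i _; rewrite /m /patch; case: ifPn => // /set_mem it.
  by exfalso; apply: noi; exists i.
rewrite (bigD1 i)//= big1 ?adde0 => [|j ji].
  rewrite /m /patch mem_set// lee_fin ler_pdivrMl//.
  by have [] := hd i t (ltn_ord i) _; rewrite // -in_itv.
rewrite /m /patch; case: ifPn => // /set_mem/=; rewrite in_itv/= => /andP[jt tj].
move: it; rewrite in_itv/= => /andP[it ti]; exfalso.
move: ji; rewrite -val_eqE neq_ltn => /orP[] ij.
  have := smono j.+1 i; rewrite ij ltnW// => /(_ isT).
  by rewrite leNgt (lt_trans it tj).
have := smono i.+1 j; rewrite ij ltnW// => /(_ isT).
by rewrite leNgt (lt_trans jt ti).
Qed.

End incr.

(** * Derivatives of cutoffs and projectors *)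
Section calculus.
Context {R : realType}.

(** [C1_on] is phrased with difference quotients based at s and t. *)
Lemma is_derive_quotP (V : normedModType R) (f : R -> V) (t : R) (df : V) :
  is_derive t (1 : R) f df <-> (s - t)^-1 *: (f s - f t) @[s --> t^'] --> df.
Proof.
have fE : (fun h : R => h^-1 *: ((f \o shift t) (h *: (1 : R)) - f t)) =
    (fun s => (s - t)^-1 *: (f s - f t)) \o (fun h => h + t).
  by apply/funext => h /=; rewrite addrK [h *: _]mulr1.
have gE : (fun s => (s - t)^-1 *: (f s - f t)) =
    (fun h : R => h^-1 *: ((f \o shift t) (h *: (1 : R)) - f t)) \o (fun s => s - t).
  by apply/funext => h /=; rewrite [_ *: 1]mulr1 subrK.
split=> [[/cvg_ex[l fl] <-]|fl].
  rewrite gE; apply: (@cvg_comp _ _ _ (fun s => s - t) _ _ 0^').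
    move=> A /nbhs_ballP[e /= e0 eA]; apply/nbhs_ballP; exists e => // s ts st.
    by apply: eA; rewrite /ball/= ?sub0r ?normrN ?subr_eq0 // distrC.
  by rewrite /derive (cvg_lim _ fl).
have fl' : h^-1 *: ((f \o shift t) (h *: (1 : R)) - f t) @[h --> 0^'] --> df.
  rewrite fE; apply: (@cvg_comp _ _ _ (fun h => h + t) _ _ t^') => //.
  move=> A /nbhs_ballP[e /= e0 eA]; apply/nbhs_ballP; exists e => // s ts st.
  apply: eA; last by rewrite -subr_eq0 addrK.
  by move: ts; rewrite /ball/= sub0r normrN opprD addrCA subrr addr0 normrN.
by apply: DeriveDef; [apply/cvg_ex; exists df|rewrite /derive (cvg_lim _ fl')].
Qed.

(** A second order estimate determines the derivative; it holds for polynomials of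
    degree at most 2 and also for the cutoff, across its threshold. *)
Lemma is_derive_quadratic (f : R -> R) (x a K : R) :
  (forall y, `|f y - f x - a * (y - x)| <= K * (y - x) ^+ 2) -> is_derive x 1 f a.
Proof.
move=> fK; apply/is_derive_quotP/cvgrPdist_le => e e0 /=.
near=> y.
have yx : y != x by near: y; exact: nbhs_dnbhs_neq.
have yx0 : 0 < `|y - x| by rewrite normr_gt0 subr_eq0.
rewrite distrC -(ler_pM2r yx0) -normrM mulrBl [_ *: _]mulrC mulfVK ?subr_eq0//.
apply: (le_trans (fK y)).
rewrite -(@real_normK _ (y - x)) ?num_real// expr2 mulrA ler_pM2r//.
have K1 : 0 < `|K| + 1 by rewrite ltr_pwDr.
apply: (@le_trans _ _ ((`|K| + 1) * `|y - x|)).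
  by rewrite ler_pM2r// (le_trans (ler_norm _))// lerDl.
rewrite mulrC -ler_pdivlMr// distrC ltW//; near: y.
by apply: nbhs_dnbhs; apply: (nbhsx_ballx x); rewrite divr_gt0.
Unshelve. all: by end_near. Qed.

Lemma is_derive_cutoff (c x : R) : is_derive x 1 (cutoff c) (2 * Num.max 0 (x - c)).
Proof.
apply: (@is_derive_quadratic _ _ _ 1) => y; rewrite /cutoff.
rewrite (_ : y - x = (y - c) - (x - c)); last by ring.
rewrite mul1r ler_norml; move: (x - c) (y - c) => u w.
have := sqr_ge0 (w - u); rewrite !expr2 => uw.
by case: (leP 0 u) => u0; case: (leP 0 w) => w0; apply/andP; split; nra.
Qed.

Lemma is_derive_coord m n (M : R -> 'M[R]_(m, n)) (t : R) dM i j :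
  is_derive t 1 M dM -> is_derive t 1 (fun s => M s i j) (dM i j).
Proof.
move=> [dvM <-]; rewrite derive_mx// mxE.
by apply: derivableP; exact: (derivable_mxP _ _ _).1.
Qed.

Lemma is_derive_mx m n (M : R -> 'M[R]_(m, n)) (t : R) (dM : 'M[R]_(m, n)) :
  (forall i j, is_derive t 1 (fun s => M s i j) (dM i j)) -> is_derive t 1 M dM.
Proof.
move=> Md; have dv : derivable M t 1.
  by apply/derivable_mxP => i j; exact: ex_derive.
apply: DeriveDef => //; rewrite derive_mx//; apply/matrixP => i j.
by rewrite mxE; exact: derive_val.
Qed.

Lemma is_deriveMR (f g : R -> R) (t df dg : R) :
  is_derive t 1 f df -> is_derive t 1 g dg ->
  is_derive t 1 (fun s => f s * g s) (df * g t + f t * dg).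
Proof.
move=> fd gd; have := is_deriveM fd gd.
by rewrite [_ *: dg + _]addrC [g t *: df]mulrC.
Qed.

Definition dcolproj n (S : pred 'I_n) (U dU : 'M[R]_n) a b : R :=
  \sum_(l | S l) (dU a l * U b l + U a l * dU b l).

Lemma is_derive_colproj n (S : pred 'I_n) (U : R -> 'M[R]_n) (t : R) dU a b :
  is_derive t 1 U dU ->
  is_derive t 1 (fun s => colproj S (U s) a b) (dcolproj S (U t) dU a b).
Proof.
move=> Ud; apply: is_derive_bigsum => l _.
by apply: is_deriveMR; exact: is_derive_coord.
Qed.

(** The derivative of a projector only sees the rotations that mix S with its
    complement: in the expansion, the terms with both indices in S cancel by
    skew-symmetry. *)
Lemma dcolproj_skew n (S : pred 'I_n) (U B : 'M[R]_n) a b : Defs.skew B ->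
  dcolproj S U (U *m B) a b =
  \sum_(l | S l) \sum_(j | ~~ S j) B j l * (U a j * U b l + U a l * U b j).
Proof.
move=> sB; have BE i j : B i j = - B j i.
  by have /matrixP/(_ j i) := (sB : _ = _); rewrite !mxE.
transitivity (\sum_(l | S l) \sum_j B j l * (U a j * U b l + U a l * U b j)).
  apply: eq_bigr => l _; rewrite !mxE mulr_suml mulr_sumr -big_split/=.
  by apply: eq_bigr => j _; ring.
under eq_bigr do rewrite (bigID S)/=.
rewrite big_split/= [X in X + _](_ : _ = 0) ?add0r//.
set s := LHS; suff : s = - s by move=> /eqP; rewrite -addr_eq0 -mulr2n mulrn_eq0 => /eqP.
rewrite {1}/s exchange_big/= -sumrN; apply: eq_bigr => l Sl; rewrite -sumrN.
by apply: eq_bigr => j Sj; rewrite BE; ring.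
Qed.

Lemma dcolproj_skew_le n (S : pred 'I_n) (U B : 'M[R]_n) a b v : orth U -> Defs.skew B ->
  (forall l j, S l -> ~~ S j -> `|B j l| <= v) -> 0 <= v ->
  `|dcolproj S U (U *m B) a b| <= 2 * (n * n)%:R * v.
Proof.
move=> oU sB Bv v0; rewrite dcolproj_skew//.
have U1 i j : `|U i j| <= 1 by exact: orth_entry_le1.
apply: (@le_trans _ _ (\sum_(l < n) \sum_(j < n) 2 * v)).
  apply: (le_trans (ler_norm_sum _ _ _)).
  rewrite big_mkcond/=; apply: ler_sum => l _; case: ifPn => Sl; last first.
    by rewrite sumr_ge0// => j _; rewrite mulr_ge0.
  apply: (le_trans (ler_norm_sum _ _ _)).
  rewrite big_mkcond/=; apply: ler_sum => j _; case: ifPn => Sj; last first.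
    by rewrite mulr_ge0.
  rewrite normrM mulrC; apply: ler_pM => //; last exact: Bv.
  apply: (le_trans (ler_normD _ _)); rewrite !normrM.
  have : `|U a j| * `|U b l| <= 1 * 1 by apply: ler_pM.
  have : `|U a l| * `|U b j| <= 1 * 1 by apply: ler_pM.
  lra.
by rewrite !sumr_const !card_ord -mulrnA -[leLHS]mulr_natr mulrAC lexx.
Qed.

End calculus.

(** * Velocities of paths *)
Lemma C1_on_open (R : realType) (V : normedModType R) (D G : set R) (h : R -> V) :
  C1_on D h -> open G -> G `<=` D ->
  exists dh : R -> V, forall t, G t ->
    is_derive t (1 : R) h (dh t) /\ {for t, continuous dh}.
Proof.
move=> [dh [hd dhc]] oG GD; exists dh => t Gt; split.
  apply/is_derive_quotP => A /(hd t (GD _ Gt)); rewrite /fmap/= /within/= => DA.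
  have tG : t^' G by apply: nbhs_dnbhs; apply: open_nbhs_nbhs.
  by apply: filterS2 tG DA => s /GD Ds /(_ Ds).
have : {within G, continuous dh} by exact: continuous_subspaceW dhc.
by rewrite continuous_open_subspace// => /(_ t); apply; rewrite inE.
Qed.

Section velocity.
Context {R : realType} {n : nat}.
Implicit Types (f : 'rV[R]_n -> R) (gamma : R -> wflag R n).

(** Differentiate U^T U = 1. *)
Lemma is_derive_orth_skew (U : R -> @orth R n) (t : R) (dU : 'M[R]_n) :
  is_derive t 1 (fun s => set_val (U s) : 'M[R]_n) dU ->
  Defs.skew ((set_val (U t))^T *m dU).
Proof.
move=> Ud; apply/matrixP => i j; rewrite !mxE.
have UE : (fun s => \sum_l (set_val (U s) : 'M[R]_n) l i * (set_val (U s) : 'M[R]_n) l j) =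
    fun=> (i == j)%:R.
  apply/funext => s; have /matrixP/(_ i j) := set_valP (U s) : _ = _.
  by rewrite !mxE => <-; apply: eq_bigr => l _; rewrite mxE.
have : is_derive t 1
    (fun s => \sum_l (set_val (U s) : 'M[R]_n) l i * (set_val (U s) : 'M[R]_n) l j)
    (\sum_l (dU l i * (set_val (U t) : 'M[R]_n) l j + (set_val (U t) : 'M[R]_n) l i * dU l j)).
  by apply: is_derive_bigsum => l _; apply: is_deriveMR; exact: is_derive_coord.
rewrite UE => dE; have := @derive_val _ _ _ _ _ _ _ dE.
rewrite derive_cst big_split/= => /esym/eqP.
rewrite addr_eq0 => /eqP E.
rewrite [LHS](_ : _ = \sum_l dU l i * (set_val (U t) : 'M[R]_n) l j); last first.
  by apply: eq_bigr => l _; rewrite mxE mulrC.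
by rewrite E; congr (- _); apply: eq_bigr => l _; rewrite mxE.
Qed.

Lemma lift_velocity gamma (mu : R -> @simplex R n) (U : R -> @orth R n) (t : R) dmu dU :
  (\forall s \near t, top_cell (gamma s) /\ gamma s = wflag_pi (mu s) (U s)) ->
  is_derive t 1 (fun s => set_val (mu s) : 'rV[R]_n) dmu ->
  is_derive t 1 (fun s => set_val (U s) : 'M[R]_n) dU ->
  has_velocity gamma t (set_val (mu t)) (set_val (U t)) dmu ((set_val (U t))^T *m dU).
Proof.
move=> lift mud Ud; exists mu, U; split=> //; last exact: is_derive_orth_skew.
by rewrite mulmxA (mulmx1C (set_valP (U t))) mul1mx.
Qed.

(** Around each time of an open piece, the path has a lift to weights and orthogonal
    matrices that is C^1 on a whole neighbourhood: this gives velocities as well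
    as the continuity of the derivatives of functions along the path. *)
Lemma piece_lift gamma (a b : R) (mu : R -> @simplex R n) (W : R -> flag R (ones n)) (t : R) :
  C1_on `[a, b] (fun t => set_val (mu t) : 'rV[R]_n) -> C1_flag `[a, b] W ->
  (forall t, a < t < b -> gamma t = wflag_of_full (mu t) (W t)) -> a < t < b ->
  exists (G : set R) (U : R -> @orth R n) dmu dU,
  [/\ open G, G t, G `<=` `]a, b[ & forall s, G s ->
     [/\ gamma s = wflag_pi (mu s) (U s),
         is_derive s 1 (fun s => set_val (mu s) : 'rV[R]_n) (dmu s),
         is_derive s 1 (fun s => set_val (U s) : 'M[R]_n) (dU s),
         {for s, continuous dmu} & {for s, continuous dU}]].
Proof.
move=> muC1 WC1 gE tab.
have tcc : `[a, b]%classic t by move: tab => /andP[? ?]; rewrite /= in_itv/= !ltW.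
have [e e0 [U [UC1 WU]]] := WC1 t tcc.
pose G : set R := `]a, b[ `&` ball t e.
have oG : open G by apply: openI; [exact: interval_open|exact: ball_open].
have Gab : G `<=` `]a, b[ by move=> s [].
have sub : `]a, b[ `<=` `[a, b].
  by move=> s /=; rewrite !in_itv/= => /andP[? ?]; rewrite !ltW.
have [dmu dmuP] := C1_on_open muC1 oG (subset_trans Gab sub).
have Gsub : G `<=` `[a, b] `&` ball t e by move=> s [/sub sab sball].
have [dU dUP] := C1_on_open UC1 oG Gsub.
exists G, U, dmu, dU; split=> //.
  by split; [rewrite /= in_itv|exact: ballxx].
move=> s Gs; have [? ?] := dmuP s Gs; have [? ?] := dUP s Gs; split=> //.
have [sab sball] := Gs.
rewrite gE; last by move: sab; rewrite /= in_itv.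
by rewrite (WU s); [exact: wflag_of_full_pi|split=> //; exact: sub].
Qed.

(** Infinitesimally C-Lipschitz functions: DH is the derivative of H along a lifted
    path, as an expression in the lift and its derivative. *)
Definition observable f (H : wflag R n -> R)
    (DH : 'rV[R]_n -> 'M[R]_n -> 'rV[R]_n -> 'M[R]_n -> R) (C : R) : Prop :=
  [/\ continuous H,
      forall (mu : R -> @simplex R n) (U : R -> @orth R n) (t : R) dmu dU,
        is_derive t 1 (fun s => set_val (mu s) : 'rV[R]_n) dmu ->
        is_derive t 1 (fun s => set_val (U s) : 'M[R]_n) dU ->
        is_derive t 1 (fun s => H (wflag_pi (mu s) (U s)))
          (DH (set_val (mu t)) (set_val (U t)) dmu dU),
      forall (mu dmu : R -> 'rV[R]_n) (U dU : R -> 'M[R]_n) (t : R),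
        {for t, continuous mu} -> {for t, continuous U} ->
        {for t, continuous dmu} -> {for t, continuous dU} ->
        {for t, continuous (fun s => DH (mu s) (U s) (dmu s) (dU s))} &
      forall mu U alpha B, simplex mu -> orth U -> Defs.skew B ->
        `|DH mu U alpha (U *m B)| <= C * Num.sqrt (metric f mu (alpha, B) (alpha, B))].

Lemma speed_ge0 f gamma t : 0 <= speed f gamma t.
Proof.
rewrite /speed; case: xgetP => // _ _ [mu [U [alpha [B [_ ->]]]]].
exact: sqrtr_ge0.
Qed.

(** [speed] comes from a velocity picked by [xget]; the derivative of H along the
    path is computed from that same velocity. *)
Lemma observable_speed f H DH C gamma t : observable f H DH C ->
  (exists mu U alpha B, has_velocity gamma t mu U alpha B) ->
  exists2 dh, is_derive t 1 (H \o gamma) dh & `|dh| <= C * speed f gamma t.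
Proof.
move=> [_ Hd _ HC] [mu [U [alpha [B hv]]]].
have : [set v | exists mu U alpha B, has_velocity gamma t mu U alpha B /\
    v = Num.sqrt (metric f mu (alpha, B) (alpha, B))] (speed f gamma t).
  rewrite /speed; apply: xgetPex.
  by exists (Num.sqrt (metric f mu (alpha, B) (alpha, B))), mu, U, alpha, B.
move=> {mu U alpha B hv} [mu [U [alpha [B [[mut [Ut [lift [<- <-] mud Ud sB]]] ->]]]]].
exists (DH (set_val (mut t)) (set_val (Ut t)) alpha (set_val (Ut t) *m B)).
  apply: near_eq_is_derive (Hd _ _ _ _ _ mud Ud).
  by apply: filterS lift => s [_ /= ->].
by apply: HC => //; exact: set_valP.
Qed.

Lemma observable_lipschitz f H DH C : 0 < C -> observable f H DH C ->
  forall p q, (`|H p - H q|%:E <= C%:E * wflag_dist f p q)%E.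
Proof.
move=> C0 obs p q; rewrite muleC -lee_pdivrMr//.
apply: le_ereal_inf_tmp => _ [gamma [[gc [N [s [s0 sN ss pieces]]] <- <-] <-]].
rewrite lee_pdivrMr// muleC distrC /path_length -s0 -sN.
have [Hc Hd Hdc _] := obs.
have vel i t : (i < N)%N -> s i < t < s i.+1 ->
    exists mu U alpha B, has_velocity gamma t mu U alpha B.
  move=> iN it; have [top [mu [W [muC1 WC1 gE]]]] := pieces i iN.
  have [G [U [dmu [dU [oG Gt Gs GP]]]]] := piece_lift muC1 WC1 gE it.
  have [_ mud Ud _ _] := GP t Gt.
  do 4 eexists; apply: lift_velocity mud Ud.
  have : nbhs t G by exact: open_nbhs_nbhs.
  apply: filterS => r Gr; have [gr _ _ _ _] := GP r Gr; split=> //.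
  by apply: top; have := Gs r Gr; rewrite /= in_itv.
apply: (piecewise_increment_le_integral (h := H \o gamma)
  (dh := fun t => 'D_1 (H \o gamma) t)) => //.
- by move=> t; exact: speed_ge0.
- rewrite s0 sN; apply: within_continuous_comp => // r _; exact: Hc.
move=> i t iN it; have [dh hd hC] := observable_speed obs (vel i t iN it).
rewrite (@derive_val _ _ _ _ _ _ _ hd); split=> //.
have [_ [mu [W [muC1 WC1 gE]]]] := pieces i iN.
have [G [U [dmu [dU [oG Gt Gs GP]]]]] := piece_lift muC1 WC1 gE it.
have DE : {in G, (fun s => DH (set_val (mu s)) (set_val (U s)) (dmu s) (dU s)) =1
    (fun t => 'D_1 (H \o gamma) t)}.
  move=> r; rewrite inE => Gr; have [_ mud Ud _ _] := GP r Gr.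
  apply/esym/derive_val; apply: near_eq_is_derive (Hd _ _ _ _ _ mud Ud).
  have : nbhs r G by exact: open_nbhs_nbhs.
  by apply: filterS => u Gu; have [/= -> _ _ _ _] := GP u Gu.
have [_ mud Ud muc Uc] := GP t Gt.
rewrite /prop_for /continuous_at -DE ?inE//.
apply: cvg_trans.
  apply: near_eq_cvg; have : nbhs t G by exact: open_nbhs_nbhs.
  by apply: filterS => r Gr; rewrite -DE ?inE.
apply: Hdc => //.
  by apply: differentiable_continuous; apply/derivable1_diffP; exact: ex_derive.
by apply: differentiable_continuous; apply/derivable1_diffP; exact: ex_derive.
Qed.

End velocity.

(** * Lower bound for the distance *)
Section lower_bound.
Context {R : realType} {n : nat}.
Variable f : 'rV[R]_n -> R.
Implicit Types (p q : wflag R n) (mu : 'rV[R]_n) (alpha : 'rV[R]_n) (B : 'M[R]_n).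

Lemma lipschitz_within_continuous (A : set 'rV[R]_n) :
  [lipschitz f mu | mu in A] -> {within A, continuous f}.
Proof.
move=> /pinfty_ex_gt0[K K0 fK]; apply/subspace_continuousP => x Ax.
apply/cvgrPdist_lt => e e0; near=> y.
have Ay : A y by near: y; exact: withinT.
apply: (le_lt_trans (fK (x, y) _)) => //=.
rewrite mulrC -ltr_pdivlMr//.
have : ball x (e / K) y.
  by near: y; apply: cvg_within; apply: nbhsx_ballx; rewrite divr_gt0.
by rewrite -ball_normE.
Unshelve. all: by end_near. Qed.

Lemma weight_le_metric mu alpha B k :
  `|alpha 0 k| <= Num.sqrt (metric f mu (alpha, B) (alpha, B)).
Proof.
rewrite -sqrtr_sqr ler_wsqrtr// /metric/= expr2 (bigD1 k)//= -addrA lerDl.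
rewrite addr_ge0 ?sumr_ge0// => i _; first by rewrite -expr2 sqr_ge0.
by rewrite sumr_ge0// => j _; rewrite -mulrA mulr_ge0 ?sqr_ge0// -expr2 sqr_ge0.
Qed.

Lemma rotation_le_metric mu alpha B (i j : 'I_n) : (i < j)%N ->
  `|f (segment_row mu i j) * B i j| <= Num.sqrt (metric f mu (alpha, B) (alpha, B)).
Proof.
move=> ij; rewrite -sqrtr_sqr ler_wsqrtr// /metric/= exprMn [B i j ^+ 2]expr2.
rewrite mulrA [leRHS]addrC (bigD1 i)//= (bigD1 j)//= -!addrA lerDl.
rewrite !addr_ge0 ?sumr_ge0// => [l _|k _|l _]; last by rewrite -expr2 sqr_ge0.
  by rewrite -mulrA mulr_ge0 ?sqr_ge0// -expr2 sqr_ge0.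
by rewrite sumr_ge0// => l _; rewrite -mulrA mulr_ge0 ?sqr_ge0// -expr2 sqr_ge0.
Qed.

Lemma weights_observable k :
  observable f (fun q => weights q 0 k) (fun _ _ dmu _ => dmu 0 k) 1.
Proof.
split.
- exact: weights_continuous.
- move=> mu U t dmu dU mud _; under eq_fun do rewrite weights_pi.
  exact: is_derive_coord.
- move=> mu dmu U dU t _ _ dmuc _.
  exact: (continuous_comp dmuc (@coord_continuous _ _ _ 0 k _)).
- by move=> mu U alpha B _ _ _; rewrite mul1r; exact: weight_le_metric.
Qed.

Lemma colproj_le (S : pred 'I_n) (U : 'M[R]_n) a b : orth U -> `|colproj S U a b| <= n%:R.
Proof.
move=> oU; apply: (le_trans (ler_norm_sum _ _ _)).
apply: (@le_trans _ _ (\sum_(l < n) 1)); last by rewrite sumr_const card_ord.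
rewrite big_mkcond/=; apply: ler_sum => l _; case: ifP => // _.
by rewrite normrM -[leRHS]mulr1 ler_pM// orth_entry_le1.
Qed.

Hypothesis f_ge0 : forall mu : 'rV[R]_n, cube mu -> 0 <= f mu.
Hypothesis f_lip : [lipschitz f mu | mu in @cube R n].
Hypothesis f_eq0 : forall mu : 'rV[R]_n, cube mu -> (f mu = 0 <-> mu = 0).

(** f is continuous and positive on the compact set of the points of the cube whose
    k-th entry is at least c. *)
Lemma f_lower_bound (c : R) (k : 'I_n) : 0 < c ->
  exists2 m : R, 0 < m & forall mu, cube mu -> c <= mu 0 k -> m <= f mu.
Proof.
move=> c0; pose A := @cube R n `&` (fun mu : 'rV[R]_n => mu 0 k) @^-1` [set x | c <= x].
have cA : compact A.
  apply: compact_closedI; first exact: compact_cube.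
  apply: preimage_closed; last exact: closed_ge.
  by move=> mu _; exact: coord_continuous.
have [A0|/set0P A0] := eqVneq A set0.
  exists 1 => // mu cmu cmuk; have : A mu by [].
  by rewrite A0.
have fc : {within A, continuous f}.
  by apply: continuous_subspaceW (lipschitz_within_continuous f_lip) => mu [].
have [nu] := compact_EVT_min A0 cA fc; rewrite inE => -[cnu cnuk] numin.
exists (f nu).
  rewrite lt_neqAle f_ge0// andbT eq_sym; apply/eqP => /(f_eq0 cnu) nu0.
  by move: cnuk; rewrite nu0/= mxE leNgt c0.
by move=> mu cmu cmuk; apply: numin; rewrite inE.
Qed.

Lemma segment_row_cube mu i j : cube mu -> cube (segment_row mu i j).
Proof. by move=> cmu l; rewrite mxE; case: ifP => // _; rewrite lexx ler01. Qed.

(** The derivative of the projector involves the entries b_jl with l <= k < j.  For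
    them [segment_row] keeps the k-th weight, which is at least c wherever the
    cutoff is nonzero, and [f_lower_bound] turns a bound on f b_jl into one on
    b_jl. *)
Lemma partial_flag_observable c k a b : 0 < c -> exists2 C, 0 < C &
  observable f (partial_flag c k a b)
   (fun mu U dmu dU => 2 * Num.max 0 (mu 0 k - c) * dmu 0 k *
        colproj (fun l => (l <= k)%N) U a b +
      cutoff c (mu 0 k) * dcolproj (fun l => (l <= k)%N) U dU a b) C.
Proof.
move=> c0; have [m m0 fm] := f_lower_bound k c0.
(* 2 n for the derivative of the cutoff times the projector, 2 n^2 / m for the
   cutoff times the derivative of the projector, and 1 for immediate positivity *)
exists (2 * n%:R + 1 + 2 * (n * n)%:R / m).
  have nm0 : 0 <= 2 * (n * n)%:R / m by apply: divr_ge0; [exact: mulr_ge0|exact: ltW].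
  have n0 : 0 <= n%:R :> R by exact: ler0n.
  lra.
split.
- by apply: partial_flag_continuous; exact: ltW.
- move=> mu U t dmu dU mud Ud.
  under eq_fun do rewrite partial_flag_pi ?ltW//.
  apply: is_deriveMR; last exact: is_derive_colproj.
  exact: is_derive1_comp (is_derive_cutoff _ _) (is_derive_coord 0 k mud).
- move=> mu dmu U dU t muc Uc dmuc dUc.
  have muk := continuous_comp muc (@coord_continuous _ _ _ 0 k _).
  have dmuk := continuous_comp dmuc (@coord_continuous _ _ _ 0 k _).
  have Uk := continuous_comp Uc (@colproj_continuous _ _ (fun l => (l <= k)%N) a b _).
  have posk := continuous_comp muk (@pos_part_continuous _ c _).
  have cutk := continuous_comp muk (@cutoff_continuous _ c _).
  have dUk : {for t, continuous (fun s => dcolproj (fun l => (l <= k)%N) (U s) (dU s) a b)}.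
    rewrite /prop_for /continuous_at /dcolproj.
    apply: (@cvg_sum _ _ _ _ (nbhs t)) => l _.
    have Uij i j := continuous_comp Uc (@coord_continuous _ _ _ i j _).
    have dUij i j := continuous_comp dUc (@coord_continuous _ _ _ i j _).
    exact: cvgD (cvgM (dUij a l) (Uij b l)) (cvgM (Uij a l) (dUij b l)).
  apply: cvgD; last exact: cvgM cutk dUk.
  apply: cvgM; last exact: Uk.
  apply: cvgM; last exact: dmuk.
  by apply: cvgM; [exact: cvg_cst|exact: posk].
move=> mu U alpha B [cmu smu] oU sB; set v := Num.sqrt _.
have v0 : 0 <= v by exact: sqrtr_ge0.
have muk1 : mu 0 k <= 1 by have /andP[] := cmu k.
have pos01 : 0 <= Num.max 0 (mu 0 k - c) <= 1.
  by rewrite le_max lexx/= ge_max ler01/=; lra.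
have alpha_v : `|alpha 0 k| <= v by exact: weight_le_metric.
have term1 : `|2 * Num.max 0 (mu 0 k - c) * alpha 0 k *
    colproj (fun l => (l <= k)%N) U a b| <= 2 * n%:R * v.
  move: pos01 => /andP[pos0 pos1].
  rewrite !normrM (ger0_norm pos0) ger0_norm// [leRHS]mulrAC.
  apply: ler_pM => //; last by apply: colproj_le.
    by rewrite !mulr_ge0.
  by rewrite -mulrA ler_pM2l// -[leRHS]mul1r; apply: ler_pM.
have term2 : `|cutoff c (mu 0 k) * dcolproj (fun l => (l <= k)%N) U (U *m B) a b|
    <= 2 * (n * n)%:R / m * v.
  have [kc|ck] := leP (mu 0 k) c.
    rewrite cutoff_le0// mul0r normr0; apply: mulr_ge0 => //.
    by apply: divr_ge0; [exact: mulr_ge0|exact: ltW].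
  rewrite normrM -[leRHS]mul1r; apply: ler_pM => //.
    move: pos01 => /andP[pos0 pos1].
    by rewrite ger0_norm ?exprn_ge0// /cutoff expr_le1.
  rewrite -mulrA; apply: dcolproj_skew_le => //; last first.
    by rewrite mulr_ge0// invr_ge0 ltW.
  move=> l j lk; rewrite -ltnNge => kj.
  rewrite ler_pdivlMl//; have lj := leq_ltn_trans lk kj.
  have : `|f (segment_row mu l j) * B l j| <= v by exact: rotation_le_metric.
  apply: le_trans; rewrite normrM.
  have BE : B j l = - B l j by have /matrixP/(_ l j) := (sB : _ = _); rewrite !mxE.
  rewrite BE normrN ler_wpM2r// ler_normr fm//; first exact: segment_row_cube.
  by rewrite mxE lk kj ltW.
apply: (le_trans (ler_normD _ _)); rewrite [leRHS]mulrDl.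
by apply: lerD => //; apply: (le_trans term1); rewrite [leRHS]mulrDl mul1r lerDl.
Qed.

Lemma sep_dist_le_dist p : exists2 C : R, 0 < C &
  forall q, ((sep_dist p q)%:E <= C%:E * wflag_dist f q p)%E.
Proof.
pose P (g : wflag R n -> R) := exists2 C : R, 0 < C &
  forall q, ((g q)%:E <= C%:E * wflag_dist f q p)%E.
have dist0 q : (0 <= wflag_dist f q p)%E.
  apply: le_ereal_inf_tmp => _ [gamma _ <-]; apply: integral_ge0 => t _.
  by rewrite lee_fin speed_ge0.
have P0 : P (fun=> 0).
  by exists 1 => // q; rewrite mul1e.
have PD g h : P g -> P h -> P (fun q => g q + h q).
  move=> [C C0 gC] [D D0 hD]; exists (C + D); first exact: addr_gt0.
  move=> q; rewrite [(C + D)%:E]EFinD ge0_muleDl; last 2 first.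
  - by rewrite lee_fin ltW.
  - by rewrite lee_fin ltW.
  by rewrite EFinD; exact: leeD.
have Psum (I : Type) (r : seq I) (S : pred I) (g : I -> wflag R n -> R) :
    (forall i, S i -> P (g i)) -> P (fun q => \sum_(i <- r | S i) g i q).
  move=> Pg; rewrite (_ : (fun q => _) = \sum_(i <- r | S i) g i).
    by apply: (big_ind P) => // u w; exact: PD.
  by apply/funext => q; rewrite fct_sumE.
have lip H DH C : 0 < C -> observable f H DH C -> P (fun q => `|H q - H p|).
  by move=> C0 obs; exists C => // q; exact: (observable_lipschitz C0 obs q p).
apply: PD.
  by apply: (Psum) => i _; apply: (lip _ _ _ ltr01 (weights_observable i)).
apply: (Psum) => k wk; apply: (Psum) => a _; apply: (Psum) => b _.
have c0 : 0 < weights p 0 k / 2 by rewrite divr_gt0.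
by have [C C0 obs] := partial_flag_observable k a b c0; exact: (lip _ _ _ C0 obs).
Qed.

Lemma cvg_of_dist (x : nat -> wflag R n) p :
  (wflag_dist f (x m) p @[m --> \oo] --> 0%E) -> (x m @[m --> \oo] --> p).
Proof.
move=> xp; apply/cvg_sep_dist/cvgrPdist_lt => e e0.
have [C C0 sC] := sep_dist_le_dist p.
have : \forall d \near (0%E : \bar R), (d < (e / C)%:E)%E.
  by apply: open_ereal_lt'; rewrite lte_fin divr_gt0.
move=> /xp dm; near=> m.
have dm' : (wflag_dist f (x m) p < (e / C)%:E)%E by near: m; exact: dm.
rewrite sub0r normrN ger0_norm ?sep_dist_ge0// -lte_fin.
apply: (le_lt_trans (sC (x m))).
by rewrite -lte_pdivlMl// -EFinM mulrC.
Unshelve. all: by end_near. Qed.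

End lower_bound.

(** * Matrix norms and Cayley arcs *)
Section mxnorm.
Context {R : realType}.

Lemma normr_entry_le m n (M : 'M[R]_(m, n)) i j : `|M i j| <= `|M|.
Proof. by rewrite [leRHS]/Num.Def.normr/= mx_normrE; exact: (le_bigmax _ _ (i, j)). Qed.

Lemma normr_mx_le m n (M : 'M[R]_(m, n)) c : 0 <= c ->
  (forall i j, `|M i j| <= c) -> `|M| <= c.
Proof.
move=> c0 Mc; rewrite [leLHS]/Num.Def.normr/= mx_normrE.
by apply: bigmax_le => // -[i j] _; exact: Mc.
Qed.

Lemma normr_mulmx_le m n p (A : 'M[R]_(m, n)) (B : 'M[R]_(n, p)) :
  `|A *m B| <= n%:R * (`|A| * `|B|).
Proof.
apply: normr_mx_le => [|i j]; first by rewrite mulr_ge0// mulr_ge0.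
rewrite mxE; apply: (le_trans (ler_norm_sum _ _ _)).
apply: (@le_trans _ _ (\sum_(k < n) `|A| * `|B|)).
  by apply: ler_sum => k _; rewrite normrM ler_pM// normr_entry_le.
by rewrite sumr_const card_ord mulr_natl.
Qed.

Lemma normr_orth_le1 n (U : 'M[R]_n) : orth U -> `|U| <= 1.
Proof. by move=> oU; apply: normr_mx_le => // i j; exact: orth_entry_le1. Qed.

Lemma unitmx_inj n (A : 'M[R]_n) :
  (forall v : 'rV_n, v *m A = 0 -> v = 0) -> A \in unitmx.
Proof.
move=> A0; rewrite -row_free_unit -kermx_eq0; apply/rowV0P => v.
by move=> /sub_kermxP; exact: A0.
Qed.

End mxnorm.

Section cayley.
Context {R : realType} {n : nat}.
Variable A : 'M[R]_n.
Hypothesis sA : Defs.skew A.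

(** If v (1 + t A) = 0 then v v^T = - t v A v^T, which vanishes by skewness. *)
Lemma unit_cayley t : 1%:M + t *: A \in unitmx.
Proof.
apply: unitmx_inj => v; rewrite mulmxDr mulmx1 => /eqP; rewrite addr_eq0 => /eqP vE.
have vAv : (v *m A *m v^T) 0 0 = 0.
  apply/eqP; rewrite -[_ == 0](mulrn_eq0 _ 2) mulr2n.
  have /matrixP/(_ 0 0) : (v *m A *m v^T)^T = - (v *m A *m v^T).
    by rewrite !trmx_mul trmxK (sA : _ = _) mulNmx mulmxN mulmxA.
  by rewrite !mxE => {1}->; rewrite addNr.
have : (v *m v^T) 0 0 = 0.
  rewrite {1}vE -scalemxAr mulNmx -scalemxAl !mxE.
  by move: vAv; rewrite !mxE => ->; rewrite mulr0 oppr0.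
rewrite mxE => /eqP; rewrite psumr_eq0 => [/allP v0|i _]; last first.
  by rewrite mxE -expr2 sqr_ge0.
apply/rowP => i; rewrite mxE; have := v0 i; rewrite mem_index_enum => /(_ isT).
by rewrite mxE mulf_eq0 orbb => /eqP.
Qed.

Let G t := invmx (1%:M + t *: A).
Let GK t : (1%:M + t *: A) *m G t = 1%:M. Proof. exact/mulmxV/unit_cayley. Qed.
Let KG t : G t *m (1%:M + t *: A) = 1%:M. Proof. exact/mulVmx/unit_cayley. Qed.

(** The Cayley transform (1 - t A) (1 + t A)^-1, written with a single occurrence of
    the inverse. *)
Definition cayley t : 'M[R]_n := 2 *: invmx (1%:M + t *: A) - 1%:M.

Lemma cayley_orth t : orth (cayley t).
Proof.
rewrite /orth/=; have GT : (G t)^T *m (1%:M - t *: A) = 1%:M.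
  have : ((1%:M + t *: A) *m G t)^T = 1%:M by rewrite GK trmx1.
  by rewrite trmx_mul linearD/= linearZ/= trmx1 (sA : _ = _) scalerN.
have GG : 2 *: ((G t)^T *m G t) = (G t)^T + G t.
  have -> : (G t)^T + G t = (G t)^T *m ((1%:M + t *: A) + (1%:M - t *: A)) *m G t.
    by rewrite mulmxDr mulmxDl GT mul1mx -mulmxA GK mulmx1.
  rewrite addrACA subrr addr0 mulmxDr mulmx1 mulmxDl.
  by rewrite scaler_nat mulr2n.
have -> : (cayley t)^T = 2 *: (G t)^T - 1%:M.
  by apply/matrixP => i j; rewrite !mxE eq_sym.
rewrite /cayley -/(G t) mulmxBl mulmxBr mulmx1 mul1mx.
rewrite -scalemxAl -scalemxAr GG scalerDr.
by apply/matrixP => i j; rewrite !mxE; ring.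
Qed.

Lemma cayley0 : cayley 0 = 1%:M.
Proof. by rewrite /cayley scale0r addr0 invmx1 scaler_nat mulr2n addrK. Qed.

(** The inverse is the half-sum of two orthogonal matrices, [cayley t] and 1. *)
Lemma cayley_inv_le1 t : `|invmx (1%:M + t *: A)| <= 1.
Proof.
have -> : invmx (1%:M + t *: A) = 2^-1 *: (cayley t + 1%:M).
  by rewrite /cayley subrK scalerA mulVf// scale1r.
rewrite normrZ ger0_norm ?invr_ge0// ler_pdivrMl// mulr1.
apply: (le_trans (ler_normD _ _)).
have : `|cayley t| <= 1 by apply: normr_orth_le1; exact: cayley_orth.
have : `|1%:M : 'M[R]_n| <= 1.
  by apply: normr_orth_le1; rewrite /orth/= trmx1 mulmx1.
lra.
Qed.

(* resolvent identity: with [cayley_inv_le1], the inverse is Lipschitz in t *)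
Let GB s t : G s - G t = (t - s) *: (G s *m A *m G t).
Proof.
have -> : (t - s) *: (G s *m A *m G t) =
    G s *m ((1%:M + t *: A) - (1%:M + s *: A)) *m G t.
  rewrite opprD addrACA subrr add0r -scalerBl.
  by rewrite -scalemxAr -scalemxAl.
by rewrite mulmxBr mulmxBl KG mul1mx -mulmxA GK mulmx1.
Qed.

Let G_continuous : continuous G.
Proof.
move=> t; apply/cvgrPdist_lt => e e0.
pose K := n%:R * (n%:R * `|A|) + 1.
have K0 : 0 < K by rewrite /K ltr_wpDl// mulr_ge0// mulr_ge0.
have GL s : `|G t - G s| <= K * `|t - s|.
  rewrite GB normrZ distrC mulrC ler_wpM2r//.
  apply: (le_trans (normr_mulmx_le _ _)).
  apply: (@le_trans _ _ (n%:R * (n%:R * `|A|))); last by rewrite lerDl.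
  rewrite ler_wpM2l// -[leRHS]mulr1 ler_pM ?cayley_inv_le1//.
  apply: (le_trans (normr_mulmx_le _ _)); rewrite ler_wpM2l//.
  by rewrite -[leRHS]mul1r ler_wpM2r// cayley_inv_le1.
near=> s; apply: (le_lt_trans (GL s)).
rewrite mulrC -ltr_pdivlMr//; near: s.
by apply: (nbhsx_ballx t); rewrite divr_gt0.
Unshelve. all: by end_near. Qed.

Lemma continuous_mulmx (T : topologicalType) m p q (f : T -> 'M[R]_(m, p))
    (g : T -> 'M[R]_(p, q)) t :
  {for t, continuous f} -> {for t, continuous g} ->
  {for t, continuous (fun s => f s *m g s)}.
Proof.
move=> fc gc; apply: (@cvg_mx _ _ (nbhs t)) => i j.
rewrite mxE; under eq_cvg do rewrite mxE.
apply: (@cvg_sum _ _ _ _ (nbhs t)) => k _.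
exact: cvgM (continuous_comp fc (@coord_continuous _ _ _ i k _))
            (continuous_comp gc (@coord_continuous _ _ _ k j _)).
Qed.

Definition dcayley t : 'M[R]_n :=
  - (2 *: (invmx (1%:M + t *: A) *m A *m invmx (1%:M + t *: A))).

Lemma is_derive_cayley (t : R) : is_derive t 1 cayley (dcayley t).
Proof.
apply/is_derive_quotP.
have cE : {near t^', (fun s => - (2 *: (G s *m A *m G t))) =1
    (fun s => (s - t)^-1 *: (cayley s - cayley t))}.
  near=> s.
  have st : s - t != 0 by rewrite subr_eq0; near: s; exact: nbhs_dnbhs_neq.
  have -> : cayley s - cayley t = 2 *: (G s - G t).
    by rewrite /cayley opprB addrA subrK scalerBr.
  by rewrite GB !scalerA -scaleNr; congr (_ *: _); field.
apply: cvg_trans (near_eq_cvg cE) _.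
apply: cvgN; apply: cvgZl_tmp.
have : {for t, continuous (fun s => G s *m A *m G t)}.
  apply: continuous_mulmx; last exact: cvg_cst.
  by apply: continuous_mulmx; [exact: G_continuous|exact: cvg_cst].
by move=> /continuous_withinNx.
Unshelve. all: by end_near. Qed.

Lemma dcayley_continuous : continuous dcayley.
Proof.
move=> t; apply: cvgN; apply: cvgZl_tmp.
have : {for t, continuous (fun s => G s *m A *m G s)}; last exact.
apply: continuous_mulmx; last exact: G_continuous.
by apply: continuous_mulmx; [exact: G_continuous|exact: cvg_cst].
Qed.

Lemma dcayley_le t : `|dcayley t| <= 2 * (n%:R * (n%:R * `|A|)).
Proof.
rewrite normrN normrZ ger0_norm// ler_wpM2l//.
apply: (le_trans (normr_mulmx_le _ _)); rewrite ler_wpM2l//.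
rewrite -[leRHS]mulr1 ler_pM ?cayley_inv_le1//.
apply: (le_trans (normr_mulmx_le _ _)); rewrite ler_wpM2l//.
by rewrite -[leRHS]mul1r ler_wpM2r// cayley_inv_le1.
Qed.

End cayley.

(** A = (1 - S) (1 + S)^-1.  Its size is estimated from 2 A = (1 - S) + A (1 - S). *)
Lemma exists_cayley (R : realType) n (S : 'M[R]_n) :
  orth S -> n%:R * `|1%:M - S| <= 1 ->
  exists A : 'M[R]_n, [/\ Defs.skew A, cayley A 1 = S & `|A| <= `|1%:M - S|].
Proof.
move=> oS S1; set d := `|_| in S1 *.
have uS : 1%:M + S \in unitmx.
  apply: unitmx_inj => v vS.
  have v2 : 2 *: v = v *m (1%:M - S).
    move/eqP: vS; rewrite mulmxDr mulmx1 addrC addr_eq0 => /eqP vS.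
    by rewrite mulmxBr mulmx1 vS opprK scaler_nat mulr2n.
  apply/eqP; rewrite -normr_eq0.
  have := normr_mulmx_le v (1%:M - S); rewrite -v2 normrZ ger0_norm// -/d.
  rewrite mulrCA => h; rewrite eq_le normr_ge0 andbT.
  have : `|v| * (n%:R * d) <= `|v| * 1 by rewrite ler_wpM2l.
  lra.
pose A := (1%:M - S) *m invmx (1%:M + S).
have AS : A *m (1%:M + S) = 1%:M - S by rewrite /A -mulmxA mulVmx// mulmx1.
have SA : (1%:M + S) *m A = 1%:M - S.
  apply: (can_inj (mulmxK uS)); rewrite -mulmxA AS.
  rewrite !(mulmxDl, mulmxDr, mulmxBl, mulmxBr, mulNmx, mulmxN, mul1mx, mulmx1).
  by move: (S *m S) => SS; apply/matrixP => i j; rewrite !mxE; ring.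
have sA : Defs.skew A.
  have uST : (1%:M + S)^T \in unitmx by rewrite unitmx_tr.
  apply: (can_inj (mulKmx uST)); apply: (can_inj (mulmxK uS)).
  rewrite -trmx_mul AS -mulmxA mulNmx AS.
  have -> : (1%:M - S)^T = 1%:M - S^T by apply/matrixP => i j; rewrite !mxE eq_sym.
  have -> : (1%:M + S)^T = 1%:M + S^T by apply/matrixP => i j; rewrite !mxE eq_sym.
  rewrite !(mulmxDl, mulmxDr, mulmxBl, mulmxBr, mulNmx, mulmxN, mul1mx, mulmx1).
  rewrite (oS : _ = _).
  by move: (S^T) => ST; apply/matrixP => i j; rewrite !mxE; ring.
exists A; split=> //.
  have uA : 1%:M + A \in unitmx by have := unit_cayley sA 1; rewrite scale1r.
  rewrite /cayley scale1r; apply: (can_inj (mulmxK uA)).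
  rewrite mulmxBl mul1mx -scalemxAl mulVmx// mulmxDr mulmx1.
  move: SA; rewrite mulmxDl mul1mx => /(canRL (addKr _)) ->.
  by apply/matrixP => i j; rewrite !mxE; ring.
have A2 : 2 *: A = (1%:M - S) + A *m (1%:M - S).
  by rewrite -[X in X + _]AS -mulmxDr addrACA subrr addr0 mulmxDr mulmx1 scaler_nat mulr2n.
have := ler_normD (1%:M - S) (A *m (1%:M - S)); rewrite -A2 normrZ ger0_norm// -/d.
have := normr_mulmx_le A (1%:M - S); rewrite -/d mulrCA => h.
have : `|A| * (n%:R * d) <= `|A| * 1 by rewrite ler_wpM2l.
lra.
Qed.

(** * Upper bound for the speed *)
Lemma continuous_set_type (T U : topologicalType) (A : set U) (g : T -> A) :
  continuous (fun s => set_val (g s) : U) -> continuous g.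
Proof.
move=> /continuousP gc; apply/continuousP => _ [W oW <-].
exact: gc.
Qed.

Lemma C1_on_derive (R : realType) (V : normedModType R) (D : set R) (h k dk : R -> V) :
  (forall t, D t -> h t = k t) -> (forall t : R, is_derive t (1 : R) k (dk t)) ->
  continuous dk -> C1_on D h.
Proof.
move=> hk kd dkc; exists dk; split; last exact: continuous_subspaceT.
move=> t Dt; have /is_derive_quotP kt := kd t.
apply: cvg_trans (cvg_trans (cvg_app _ (@cvg_within _ _ _ _)) kt).
apply: near_eq_cvg; near=> s.
by rewrite (hk t Dt) hk//; near: s; exact: withinT.
Unshelve. all: by end_near. Qed.

(** The off-diagonal entries of the rotation U^T dU can be recovered from the
    derivatives of the rank one projectors onto the columns, which are insensitive
    to the signs of the columns. *)
Lemma orth_rotation_entry (R : realType) n (U dU : 'M[R]_n) (i l : 'I_n) :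
  orth U -> i != l ->
  (U^T *m dU) i l = \sum_a \sum_b U a i * U b l * dcolproj (pred1 l) U dU a b.
Proof.
move=> oU il; have oE j k : \sum_a U a j * U a k = (j == k)%:R.
  have /matrixP/(_ j k) := (oU : _ = _); rewrite !mxE => <-.
  by apply: eq_bigr => a _; rewrite mxE.
transitivity (\sum_a \sum_b (U a i * dU a l * (U b l * U b l) +
    U a i * U a l * (U b l * dU b l))).
  under eq_bigr do rewrite big_split/= -!mulr_sumr oE eqxx mulr1.
  rewrite big_split/= -mulr_suml oE (negbTE il) mul0r addr0 mxE.
  by apply: eq_bigr => a _; rewrite mxE.
apply: eq_bigr => a _; apply: eq_bigr => b _.
by rewrite /dcolproj big_pred1_eq; ring.
Qed.

Section speed_upper.
Context {R : realType} {n : nat}.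
Variables (f : 'rV[R]_n -> R) (M : R).
Hypothesis f_le : forall mu : 'rV[R]_n, cube mu -> `|f mu| <= M.

(** On the top cell two lifts of a path differ by the signs of the columns, so the
    rank one projectors agree along both lifts, and so do their derivatives.  Thus
    every velocity is controlled by the derivative of one given lift. *)
Lemma velocity_entries gamma (t : R) mu0 U0 alpha B
    (mu : R -> @simplex R n) (V : R -> @orth R n) dmu dV :
  has_velocity gamma t mu0 U0 alpha B ->
  (\forall s \near t, gamma s = wflag_pi (mu s) (V s)) ->
  is_derive t 1 (fun s => set_val (mu s) : 'rV[R]_n) dmu ->
  is_derive t 1 (fun s => set_val (V s) : 'M[R]_n) dV ->
  [/\ cube mu0, alpha = dmu &
      forall i j, i != j -> `|B i j| <= 2 * (n * n)%:R * `|dV| ].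
Proof.
move=> [mut [Ut [lift [<- <-] mud Ud sB]]] gE mud' Vd'.
have lift' : \forall s \near t, mut s = mu s /\ (forall l a b,
    colproj (pred1 l) (set_val (Ut s)) a b = colproj (pred1 l) (set_val (V s)) a b).
  near=> s.
  have [top gs] : top_cell (gamma s) /\ gamma s = wflag_pi (mut s) (Ut s) by near: s.
  have gs' : gamma s = wflag_pi (mu s) (V s) by near: s.
  move: top; rewrite gs => top.
  move: gs'; rewrite gs => /wflag_pi_eq[mE /orth_block_tauP[oQ Q0]]; split=> // l a b.
  rewrite -[set_val (V s)]mul1mx -(mulmx1C (set_valP (Ut s))) -mulmxA colproj_mulmxr// => i j.
  have pos k : 0 < (set_val (mut s) : 'rV[R]_n) 0 k by have := top k; rewrite weights_pi.
  move=> ij; have : i != j by apply: contraNneq ij => ->.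
  rewrite -val_eqE neq_ltn => /orP[] lt_ij.
    by have [] := Q0 i j i _ (pos i); rewrite ?leqnn.
  by have [] := Q0 j i j _ (pos j); rewrite ?leqnn.
split.
- by have [] := set_valP (mut t).
- rewrite -(@derive_val _ _ _ _ _ _ _ mud) -(@derive_val _ _ _ _ _ _ _ mud').
  by apply: near_eq_derive; apply: filterS lift' => s [-> _].
move=> i l il.
have BE : B = (set_val (Ut t))^T *m (set_val (Ut t) *m B).
  by rewrite mulmxA (set_valP (Ut t) : _ = _) mul1mx.
have dE a b : dcolproj (pred1 l) (set_val (Ut t)) (set_val (Ut t) *m B) a b =
    dcolproj (pred1 l) (set_val (V t)) dV a b.
  have d1 := is_derive_colproj (pred1 l) a b Ud.
  have d2 := is_derive_colproj (pred1 l) a b Vd'.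
  rewrite -(@derive_val _ _ _ _ _ _ _ d1) -(@derive_val _ _ _ _ _ _ _ d2).
  by apply: near_eq_derive; apply: filterS lift' => s [_ ->].
rewrite BE orth_rotation_entry//; last exact: set_valP.
apply: (le_trans (ler_norm_sum _ _ _)).
apply: (@le_trans _ _ (\sum_(a < n) \sum_(b < n) 2 * `|dV|)); last first.
  by rewrite !sumr_const !card_ord -mulrnA -[leLHS]mulr_natr mulrAC lexx.
apply: ler_sum => a _; apply: (le_trans (ler_norm_sum _ _ _)).
apply: ler_sum => b _; rewrite dE normrM -[leRHS]mul1r; apply: ler_pM => //.
  rewrite normrM -[leRHS]mulr1; apply: ler_pM => //.
    by apply: orth_entry_le1; exact: set_valP.
  by apply: orth_entry_le1; exact: set_valP.
rewrite /dcolproj big_pred1_eq; apply: (le_trans (ler_normD _ _)).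
have V1 c d : `|(set_val (V t) : 'M[R]_n) c d| <= 1 by apply: orth_entry_le1; exact: set_valP.
have dV1 c d : `|dV c d| <= `|dV| by exact: normr_entry_le.
rewrite !normrM.
have : `|dV a l| * `|(set_val (V t) : 'M[R]_n) b l| <= `|dV| * 1 by apply: ler_pM.
have : `|(set_val (V t) : 'M[R]_n) a l| * `|dV b l| <= 1 * `|dV| by apply: ler_pM.
lra.
Unshelve. all: by end_near. Qed.

Lemma sqrt_metric_le (mu alpha : 'rV[R]_n) (B : 'M[R]_n) w u : 0 <= w -> 0 <= u ->
  0 <= M -> cube mu ->
  (forall i, `|alpha 0 i| <= w) -> (forall i j, i != j -> `|B i j| <= u) ->
  Num.sqrt (metric f mu (alpha, B) (alpha, B)) <= n%:R * w + n%:R * (M * u).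
Proof.
move=> w0 u0 M0 cmu aw Bu.
have K0 : 0 <= n%:R * w + n%:R * (M * u) by rewrite addr_ge0 ?mulr_ge0.
rewrite -[leRHS]ger0_norm// -sqrtr_sqr ler_wsqrtr//.
have nn : n%:R <= n%:R ^+ 2 :> R.
  by rewrite -natrX ler_nat; case: (n) => // k; rewrite expnS expn1 leq_pmulr.
have s1 : \sum_i alpha 0 i * alpha 0 i <= n%:R ^+ 2 * w ^+ 2.
  apply: (@le_trans _ _ (\sum_(i < n) w ^+ 2)).
    apply: ler_sum => i _; rewrite -expr2 -(@real_normK _ (alpha 0 i)) ?num_real//.
    by rewrite lerXn2r ?nnegrE.
  by rewrite sumr_const card_ord -[leLHS]mulr_natl ler_wpM2r// sqr_ge0.
have s2 : \sum_(i < n) \sum_(j < n | (i < j)%N) f (segment_row mu i j) ^+ 2 * B i j * B i j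
    <= n%:R ^+ 2 * (M * u) ^+ 2.
  apply: (@le_trans _ _ (\sum_(i < n) \sum_(j < n) (M * u) ^+ 2)); last first.
    by rewrite !sumr_const !card_ord -mulrnA -[leLHS]mulr_natl natrM expr2.
  apply: ler_sum => i _; rewrite big_mkcond/=; apply: ler_sum => j _.
  case: ifPn => ij; last exact: sqr_ge0.
  rewrite -mulrA -expr2 -exprMn -(@real_normK _ (_ * _)) ?num_real//.
  rewrite lerXn2r ?nnegrE ?mulr_ge0// normrM ler_pM ?f_le//.
    exact: segment_row_cube.
  by apply: Bu; rewrite -val_eqE neq_ltn ij.
rewrite /metric/=; apply: (le_trans (lerD s1 s2)).
have p : 0 <= (n%:R * w) * (n%:R * (M * u)) by rewrite !mulr_ge0.
rewrite -!exprMn sqrrD -addrA lerD2l lerDr mulrn_wge0//.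
Qed.

Lemma speed_le gamma (t : R) (mu : R -> @simplex R n) (V : R -> @orth R n) dmu dV w :
  0 <= M ->
  (\forall s \near t, gamma s = wflag_pi (mu s) (V s)) ->
  is_derive t 1 (fun s => set_val (mu s) : 'rV[R]_n) dmu ->
  is_derive t 1 (fun s => set_val (V s) : 'M[R]_n) dV ->
  (forall i, `|dmu 0 i| <= w) -> 0 <= w ->
  speed f gamma t <= n%:R * w + n%:R * (M * (2 * (n * n)%:R * `|dV|)).
Proof.
move=> M0 gE mud Vd dw w0; have dV0 : 0 <= `|dV| by [].
have u0 : 0 <= 2 * (n * n)%:R * `|dV| by rewrite !mulr_ge0.
rewrite /speed; case: xgetP => [_ _ [mu0 [U0 [alpha [B [hv ->]]]]]|_].
  have [cmu -> Bu] := velocity_entries hv gE mud Vd.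
  exact: sqrt_metric_le.
by rewrite addr_ge0// ?mulr_ge0// mulr_ge0.
Qed.

End speed_upper.

(** The end points, where nothing is assumed on the speed, form a null set. *)
Lemma path_length_le (R : realType) n (f : 'rV[R]_n -> R) gamma (K : R) :
  (forall t : R, 0 < t < 1 -> speed f gamma t <= K) ->
  (path_length f 0 1 gamma <= K%:E)%E.
Proof.
move=> sK; pose g (t : R) : \bar R := if 0 < t < 1 then K%:E else (speed f gamma t)%:E.
apply: (@le_trans _ _ (\int[@lebesgue_measure R]_(t in `[0%R, 1%R]) g t)%E).
  apply: ge0_le_integral_nonmeasurable => t _; first by rewrite lee_fin speed_ge0.
  by rewrite /g; case: ifPn => // t01; rewrite lee_fin sK.
have gK : {in (`]0, 1[%classic : set R), g =1 cst K%:E}.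
  by move=> t; rewrite inE/= in_itv/= /g => ->.
have mg : measurable_fun (`]0, 1[%classic : set R) g.
  by apply: (eq_measurable_fun (cst K%:E)) => // t /gK.
rewrite (integral_itv_bndoo true false mg) (eq_integral (cst K%:E))//.
rewrite integral_cst//.
have m1 : lebesgue_measure (`]0, 1[%classic : set R) = 1%E.
  by rewrite lebesgue_measure_itv/= lte_fin ltr01 oppr0 adde0.
by rewrite [X in (_ * X)%E]m1 mule1.
Qed.

(** * Short paths between close representatives *)
Section path.
Context {R : realType} {n : nat}.
Hypothesis n_gt0 : (0 < n)%N.
Implicit Types (nu mu : 'rV[R]_n) (e t : R).

(** Turns paths on [0, 1] into total functions with values in the simplex, without
    losing continuity. *)
Definition clamp t : R := Num.max 0 (Num.min 1 t).

Lemma clamp01 t : 0 <= clamp t <= 1.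
Proof. by rewrite /clamp le_max lexx/= ge_max ler01/= ge_min lexx. Qed.

Lemma clamp_id t : 0 <= t <= 1 -> clamp t = t.
Proof. by move=> /andP[t0 t1]; rewrite /clamp min_r// max_r. Qed.

Lemma clamp_continuous : continuous clamp.
Proof.
move=> t; apply: (@continuous_max _ _ (fun=> 0) (fun t => Num.min 1 t)).
  exact: cvg_cst.
by apply: (@continuous_min _ _ (fun=> 1) id); [exact: cvg_cst|exact: cvg_id].
Qed.

(** The segment from nu to mu pushed towards the barycentre by e t (1 - t), so that
    all weights are positive for 0 < t < 1 even if nu and mu are on the
    boundary. *)
Definition path_weights e nu mu t : 'rV[R]_n :=
  \row_i ((nu 0 i + t * (mu 0 i - nu 0 i)) +
     (e * (t * (1 - t))) * (n%:R^-1 - (nu 0 i + t * (mu 0 i - nu 0 i)))).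

Definition dpath_weights e nu mu t : 'rV[R]_n :=
  \row_i ((mu 0 i - nu 0 i) +
     (e * (1 - 2 * t) * (n%:R^-1 - (nu 0 i + t * (mu 0 i - nu 0 i))) +
      (e * (t * (1 - t))) * - (mu 0 i - nu 0 i))).

Lemma is_derive_path_weights e nu mu t :
  is_derive t 1 (path_weights e nu mu) (dpath_weights e nu mu t).
Proof.
apply: is_derive_mx => j i; rewrite mxE; under eq_fun do rewrite mxE.
apply: is_deriveD; first by apply: (@is_derive_quadratic _ _ _ _ 0) => y;
  rewrite mul0r normr_le0; apply/eqP; ring.
apply: is_deriveMR; last first.
  by apply: (@is_derive_quadratic _ _ _ _ 0) => y; rewrite mul0r normr_le0; apply/eqP; ring.
apply: (@is_derive_quadratic _ _ _ _ `|e|) => y.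
rewrite (_ : _ - _ - _ = - e * (y - t) ^+ 2); last by ring.
by rewrite normrM normrN (ger0_norm (sqr_ge0 _)).
Qed.

Lemma row_continuous_of_derive (g : R -> 'rV[R]_n) (dg : R -> 'rV[R]_n) :
  (forall t : R, is_derive t 1 g (dg t)) -> continuous g.
Proof.
move=> gd t; apply: differentiable_continuous; apply/derivable1_diffP.
exact: (@ex_derive _ _ _ _ _ _ _ (gd t)).
Qed.

Lemma dpath_weights_continuous e nu mu : continuous (dpath_weights e nu mu).
Proof.
move=> t; apply: (@cvg_mx _ _ (nbhs t)) => j i.
rewrite mxE; under eq_cvg do rewrite mxE.
have L : nu 0 i + x * (mu 0 i - nu 0 i) @[x --> t] --> nu 0 i + t * (mu 0 i - nu 0 i).
  by apply: cvgD; [exact: cvg_cst|apply: cvgM; [exact: cvg_id|exact: cvg_cst]].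
apply: cvgD; first exact: cvg_cst.
apply: cvgD; apply: cvgM.
- apply: cvgM; first exact: cvg_cst.
  apply: cvgB; first exact: cvg_cst.
  by apply: cvgM; [exact: cvg_cst|exact: cvg_id].
- by apply: cvgB; [exact: cvg_cst|exact: L].
- apply: cvgM; first exact: cvg_cst.
  apply: cvgM; first exact: cvg_id.
  by apply: cvgB; [exact: cvg_cst|exact: cvg_id].
- exact: cvg_cst.
Qed.

Let n0 : 0 < n%:R :> R. Proof. by rewrite ltr0n. Qed.

Lemma segment_bounds nu mu t i : simplex nu -> simplex mu -> 0 <= t <= 1 ->
  0 <= nu 0 i + t * (mu 0 i - nu 0 i) <= 1.
Proof.
move=> [/(_ i)/andP[nu0 nu1] _] [/(_ i)/andP[mu0 mu1] _] /andP[t0 t1].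
by apply/andP; split; nra.
Qed.

Lemma path_weights_ge nu mu e t i : simplex nu -> simplex mu -> 0 <= e <= 1 ->
  0 <= t <= 1 -> e * (t * (1 - t)) * n%:R^-1 <= path_weights e nu mu t 0 i.
Proof.
move=> snu smu /andP[e0 e1] t01; have /andP[L0 L1] := segment_bounds i snu smu t01.
rewrite mxE; set L := _ + _ * _ in L0 L1 *; move: t01 => /andP[t0 t1].
have p0 : 0 <= t * (1 - t) <= 1 by apply/andP; split; nra.
have ep : 0 <= 1 - e * (t * (1 - t)) by move: p0 => /andP[p0 p1]; nra.
have := mulr_ge0 ep L0; lra.
Qed.

Lemma path_weights_simplex nu mu e t : simplex nu -> simplex mu -> 0 <= e <= 1 ->
  0 <= t <= 1 -> simplex (path_weights e nu mu t).
Proof.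
move=> snu smu e01 t01.
have ge0 i : 0 <= path_weights e nu mu t 0 i.
  apply: le_trans (path_weights_ge i snu smu e01 t01).
  move: e01 t01 => /andP[e0 e1] /andP[t0 t1].
  by rewrite mulr_ge0 ?invr_ge0 ?ler0n// mulr_ge0// mulr_ge0// subr_ge0.
have sum1 : \sum_i path_weights e nu mu t 0 i = 1.
  under eq_bigr do rewrite mxE.
  have Ls : \sum_i (nu 0 i + t * (mu 0 i - nu 0 i)) = 1.
    rewrite big_split/= -mulr_sumr sumrB snu.2 smu.2; ring.
  rewrite big_split/= -mulr_sumr sumrB Ls sumr_const card_ord -[_ *+ n]mulr_natl.
  by rewrite mulfV ?gt_eqF// subrr mulr0 addr0.
split=> // i; rewrite ge0/= -sum1 (bigD1 i)//= lerDl.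
by apply: sumr_ge0 => j _.
Qed.

Lemma dpath_weights_le nu mu e t (d : R) : simplex nu -> simplex mu -> 0 <= e <= 1 ->
  0 <= t <= 1 -> (forall i, `|mu 0 i - nu 0 i| <= d) ->
  forall i, `|dpath_weights e nu mu t 0 i| <= 2 * d + e.
Proof.
move=> snu smu /andP[e0 e1] t01 dd i; have /andP[L0 L1] := segment_bounds i snu smu t01.
rewrite mxE; set L := nu 0 i + _ * _ in L0 L1 *; move: t01 => /andP[t0 t1].
have Di := dd i; set D := mu 0 i - nu 0 i in Di *.
have t12 : `|1 - 2 * t| <= 1 by rewrite ler_norml; lra.
have n1 : 0 <= (n%:R^-1 : R) <= 1.
  by rewrite invr_ge0 ler0n/= invf_le1// ler1n.
have nL : `|n%:R^-1 - L| <= 1 by move: n1 => /andP[? ?]; rewrite ler_norml; lra.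
have p0 : 0 <= e * (t * (1 - t)) <= 1.
  have ? : 0 <= t * (1 - t) <= 1 by apply/andP; split; nra.
  by apply/andP; split; nra.
have h1 : `|e * (1 - 2 * t) * (n%:R^-1 - L)| <= e * 1 * 1.
  rewrite !normrM (ger0_norm e0); apply: ler_pM => //; first by rewrite mulr_ge0.
  by rewrite ler_wpM2l.
have h2 : `|e * (t * (1 - t)) * - D| <= 1 * d.
  move: p0 => /andP[p0 p1]; rewrite normrM normrN (ger0_norm p0).
  exact: ler_pM.
have := ler_normD D (e * (1 - 2 * t) * (n%:R^-1 - L) + e * (t * (1 - t)) * - D).
have := ler_normD (e * (1 - 2 * t) * (n%:R^-1 - L)) (e * (t * (1 - t)) * - D).
lra.
Qed.

Lemma is_derive_mulmxl m p (A : 'M[R]_(m, n)) (g : R -> 'M[R]_(n, p)) t dg :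
  is_derive t 1 g dg -> is_derive t 1 (fun s => A *m g s) (A *m dg).
Proof.
move=> gd; apply: is_derive_mx => i j; rewrite mxE; under eq_fun do rewrite mxE.
apply: is_derive_bigsum => k _.
have := is_deriveMR (is_derive_cst (A i k) t 1) (is_derive_coord k j gd).
by rewrite mul0r add0r.
Qed.

Variables (f : 'rV[R]_n -> R) (M : R).
Hypothesis f_le : forall mu : 'rV[R]_n, cube mu -> `|f mu| <= M.

(** The path has a single C^1 piece, with weights [path_weights] and a Cayley arc on
    the orthogonal factor; its length is at most its maximal speed. *)
Lemma dist_le_path (nu mu : @simplex R n) (V U : @orth R n) (A : 'M[R]_n) d :
  0 < d <= 1 ->
  (forall i, `|(set_val mu : 'rV[R]_n) 0 i - (set_val nu : 'rV[R]_n) 0 i| <= d) ->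
  Defs.skew A -> set_val U = set_val V *m cayley A 1 ->
  (wflag_dist f (wflag_pi nu V) (wflag_pi mu U) <=
   (n%:R * (3 * d) + n%:R * (M * (2 * (n * n)%:R *
      (n%:R * (2 * (n%:R * (n%:R * `|A|)))))))%:E)%E.
Proof.
move=> /andP[d0 d1] mnd sA UV.
have snu := set_valP nu; have smu := set_valP mu.
have d01 : 0 <= d <= 1 by rewrite ltW.
pose w := path_weights d (set_val nu) (set_val mu).
pose dw := dpath_weights d (set_val nu) (set_val mu).
have ws t : simplex (w (clamp t)) by exact: path_weights_simplex (clamp01 t).
have Vo t : orth (set_val V *m cayley A t).
  rewrite /orth/= trmx_mul mulmxA -(mulmxA (cayley A t)^T).
  by rewrite (set_valP V : _ = _) mulmx1; exact: cayley_orth.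
pose mt t : @simplex R n := SigSub (mem_set (ws t)).
pose Vt t : @orth R n := SigSub (mem_set (Vo t)).
have wd (t : R) : is_derive t 1 w (dw t) by exact: is_derive_path_weights.
have Vd (t : R) : is_derive t 1 (fun s => set_val (Vt s) : 'M[R]_n) (set_val V *m dcayley A t).
  by apply: is_derive_mulmxl; exact: is_derive_cayley.
have Vdc : continuous (fun t : R => set_val V *m dcayley A t).
  move=> t; apply: (@continuous_mulmx _ _ _ _ _ (fun=> set_val V) (dcayley A)).
    exact: cvg_cst.
  exact: dcayley_continuous.
have mtE t : 0 <= t <= 1 -> set_val (mt t) = w t.
  by move=> t01; transitivity (w (clamp t)) => //; rewrite clamp_id.
pose gamma t := wflag_pi (mt t) (Vt t).
have gammaC : continuous gamma.
  have mtc : continuous mt.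
    apply: continuous_set_type => t.
    exact: (continuous_comp (@clamp_continuous t) (@row_continuous_of_derive _ _ wd _)).
  have Vtc : continuous Vt.
    apply: continuous_set_type => t; apply: differentiable_continuous.
    by apply/derivable1_diffP; exact: (@ex_derive _ _ _ _ _ _ _ (Vd t)).
  move=> t; apply: (@continuous_comp _ _ _ (fun s => (mt s, Vt s)) (\pi_(wflag R n))).
    exact: (cvg_pair (mtc t) (Vtc t)).
  exact: pi_continuous.
apply: ge_ereal_inf; exists (path_length f 0 1 gamma).
  exists gamma => //; split.
  - split; first exact: continuous_subspaceT.
    exists 1%N, (fun k => k%:R); split=> //; first by move=> i _; rewrite ltr_nat.
    move=> [|//] _; split.
      move=> t /andP[t0 t1] i; rewrite weights_pi mtE ?(ltW t0) ?(ltW t1)//.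
      apply: lt_le_trans (path_weights_ge i snu smu d01 _); last by rewrite !ltW.
      by rewrite mulr_gt0 ?invr_gt0// mulr_gt0// mulr_gt0// subr_gt0.
    exists mt, (fun t => flag_pi (ones n) (Vt t)); split.
    + apply: (C1_on_derive (k := w) (dk := dw)) => //.
      exact: dpath_weights_continuous.
    + move=> t _; exists 1 => //; exists Vt; split=> //.
      exact: (C1_on_derive (k := fun s => set_val (Vt s)) _ Vd Vdc).
    + by move=> t _; rewrite wflag_of_full_pi.
  - apply/wflag_pi_eq; split.
      apply/val_inj; rewrite -[LHS]/(set_val (mt 0)) mtE ?lexx ?ler01//.
      by apply/rowP => i; rewrite mxE !(mul0r, mulr0, addr0).
    suff -> : set_val (Vt 0) = set_val V by rewrite (set_valP V : _ = _); exact: orth_block1.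
    by rewrite -[LHS]/(set_val V *m cayley A 0) cayley0 mulmx1.
  - apply/wflag_pi_eq; split.
      apply/val_inj; rewrite -[LHS]/(set_val (mt 1)) mtE ?lexx ?ler01//.
      by apply/rowP => i; rewrite mxE subrr !(mul1r, mulr0, mul0r, addr0) subrKC.
    suff -> : set_val (Vt 1) = set_val U by rewrite (set_valP U : _ = _); exact: orth_block1.
    by rewrite -[LHS]/(set_val V *m cayley A 1) UV.
apply: path_length_le => t t01.
have M0 : 0 <= M by apply: le_trans (f_le snu.1).
have near01 : \forall s \near t, 0 <= s <= 1.
  have : nbhs t (`]0, 1[%classic : set R).
    by apply: open_nbhs_nbhs; split; [exact: interval_open|rewrite /= in_itv].
  by apply: filterS => s; rewrite /= in_itv/= => /andP[? ?]; rewrite !ltW.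
have md : is_derive t 1 (fun s => set_val (mt s) : 'rV[R]_n) (dw t).
  by apply: near_eq_is_derive (wd t); apply: filterS near01 => s /mtE ->.
have dwt i : `|dw t 0 i| <= 3 * d.
  rewrite (_ : 3 * d = 2 * d + d); last by ring.
  by apply: dpath_weights_le => //; exact: nbhs_singleton near01.
have gE : \forall s \near t, gamma s = wflag_pi (mt s) (Vt s) by near=> s.
have d3 : 0 <= 3 * d by rewrite mulr_ge0// ltW.
apply: (le_trans (speed_le f_le M0 gE md (Vd t) dwt d3)).
rewrite lerD2l ler_wpM2l// ler_wpM2l// ler_wpM2l// ?mulr_ge0//.
apply: (le_trans (normr_mulmx_le _ _)); rewrite ler_wpM2l//.
rewrite -[leRHS]mul1r ler_pM// ?dcayley_le//.
by apply: normr_orth_le1; exact: set_valP.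
Unshelve. all: by end_near. Qed.

End path.

(** * Equivalence of the two convergences *)
(** A point q with small [sep_dist p q] has a representative close to (mu, U Q) for
    some Q in O(tau mu), where p = (mu, U).  Since (mu, U Q) represents p as well,
    it is enough to join these two close representatives. *)
Lemma dist_of_cvg (R : realType) n (f : 'rV[R]_n -> R) (x : nat -> wflag R n)
    (p : wflag R n) : (0 < n)%N -> [lipschitz f mu | mu in @cube R n] ->
  (x m @[m --> \oo] --> p) -> (wflag_dist f (x m) p @[m --> \oo] --> 0%E).
Proof.
move=> n_gt0 f_lip /cvg_sep_dist xp.
have [M fM] : exists M, forall mu, cube mu -> `|f mu| <= M.
  have := continuous_compact (lipschitz_within_continuous f_lip) (@compact_cube R n).
  move=> /compact_bounded/pinfty_ex_gt0[M _ fM]; exists M => mu cmu.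
  by apply: fM; exists mu.
have dist0 q : (0 <= wflag_dist f q p)%E.
  apply: le_ereal_inf_tmp => _ [gamma _ <-]; apply: integral_ge0 => t _.
  by rewrite lee_fin speed_ge0.
have key (eta : R) : 0 < eta ->
    exists2 e : R, 0 < e & forall q, sep_dist p q < e -> (wflag_dist f q p <= eta%:E)%E.
  move=> eta0.
  (* [dist_le_path] with |A| <= n d bounds the distance by K d *)
  pose K := n%:R * 3 + n%:R * (M * (2 * (n * n)%:R * (n%:R * (2 * (n%:R * (n%:R * n%:R)))))).
  have M0 : 0 <= M.
    apply: le_trans (fM 0 _) => // i; rewrite mxE lexx ler01//.
  have K0 : 0 <= K by rewrite addr_ge0// !mulr_ge0.
  (* d = 1 / D makes d <= 1, n^2 d <= 1 (as required by [exists_cayley]) and K d <= eta *)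
  pose D := 1 + (n%:R * n%:R + K / eta).
  have Ke : 0 <= K / eta by rewrite divr_ge0// ltW.
  have nn0 : 0 <= n%:R * n%:R :> R by rewrite mulr_ge0.
  have D1 : 1 <= D by rewrite lerDl addr_ge0.
  have D0 : 0 < D by exact: lt_le_trans D1.
  pose d := D^-1.
  have d0 : 0 < d by rewrite invr_gt0.
  have d1 : d <= 1 by rewrite invf_le1.
  have nd : n%:R * (n%:R * d) <= 1.
    by rewrite mulrA ler_pdivrMr// mul1r /D; lra.
  have Kd : K * d <= eta.
    by rewrite ler_pdivrMr// mulrC -ler_pdivrMr// /D; lra.
  pose mu := (repr p).1; pose U := (repr p).2.
  pose Psi (Q : 'M[R]_n) (z : (@simplex R n * @orth R n)%type) :=
    \sum_i `|(set_val z.1 : 'rV[R]_n) 0 i - (set_val mu : 'rV[R]_n) 0 i| +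
    \sum_i \sum_j `|(set_val z.2 : 'M[R]_n) i j - (set_val U *m Q) i j|.
  have Psic Q : continuous (Psi Q).
    have c1 : continuous (fun z : (@simplex R n * @orth R n)%type =>
        \sum_i `|(set_val z.1 : 'rV[R]_n) 0 i - (set_val mu : 'rV[R]_n) 0 i|).
      apply: continuous_bigsum => i _; apply: continuous_absB.
      exact: simplex_coord_continuous.
    have c2 : continuous (fun z : (@simplex R n * @orth R n)%type =>
        \sum_i \sum_j `|(set_val z.2 : 'M[R]_n) i j - (set_val U *m Q) i j|).
      do 2 (apply: continuous_bigsum => ? _); apply: continuous_absB => z.
      exact: (continuous_comp (@orth_snd_continuous _ _ z) (@coord_continuous _ _ _ _ _ _)).
    by move=> z; exact: (cvgD (c1 z) (c2 z)).
  (* an open neighbourhood of the fibre of p, by pairs close to some (mu, U Q) *)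
  pose A := \bigcup_(Q in orth_block (tau (set_val mu))) (Psi Q @^-1` [set r | r < d]).
  have oA : open A.
    apply: bigcup_open => Q _; move/continuousP: (Psic Q); apply; exact: open_lt.
  have [|e e0 eA] := @sep_dist_nbhs _ _ p A oA.
    move=> mu' U'; rewrite -(wflag_repr p) => /esym/wflag_pi_eq[<- oQ].
    exists ((set_val U)^T *m set_val U') => //=.
    rewrite /Psi mulmxA (mulmx1C (set_valP U)) mul1mx !big1 ?addr0// => i _.
      by rewrite big1// => j _; rewrite subrr normr0.
    by rewrite subrr normr0.
  exists e => // q; rewrite -{1}(wflag_repr q) => /eA[Q oQ /= Psid].
  set nu := (repr q).1 in Psid; set V := (repr q).2 in Psid.
  have UQo : orth (set_val U *m Q).
    rewrite /orth/= trmx_mul mulmxA -(mulmxA Q^T) (set_valP U : _ = _) mulmx1.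
    exact: orth_block_orth oQ.
  pose U' : @orth R n := SigSub (mem_set UQo).
  have pE : p = wflag_pi mu U'.
    rewrite -[LHS]wflag_repr; apply/wflag_pi_eq; split=> //.
    by rewrite /= mulmxA (set_valP U : _ = _) mul1mx.
  have s1 : 0 <= \sum_i `|(set_val nu : 'rV[R]_n) 0 i - (set_val mu : 'rV[R]_n) 0 i|.
    by rewrite sumr_ge0.
  have s2 : 0 <= \sum_i \sum_j `|(set_val V : 'M[R]_n) i j - (set_val U *m Q) i j|.
    by rewrite sumr_ge0// => i _; rewrite sumr_ge0.
  have mnd i : `|(set_val mu : 'rV[R]_n) 0 i - (set_val nu : 'rV[R]_n) 0 i| <= d.
    rewrite distrC; apply: (le_trans _ (ltW Psid)); apply: (le_trans _ (ler_wpDr s2 (lexx _))).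
    by rewrite (bigD1 i)//= lerDl sumr_ge0.
  have VUd : `|set_val V - set_val U'| <= d.
    apply: normr_mx_le => [|i j]; first exact: ltW.
    apply: (le_trans _ (ltW Psid)); apply: (le_trans _ (ler_wpDl s1 (lexx _))).
    have -> : (set_val V - set_val U') i j = (set_val V : 'M[R]_n) i j - (set_val U *m Q) i j.
      by rewrite mxE [X in _ + X]mxE.
    rewrite (bigD1 i)//= (bigD1 j)//= -addrA lerDl addr_ge0 ?sumr_ge0// => k _.
    by rewrite sumr_ge0.
  pose S := (set_val V)^T *m set_val U'.
  have oS : orth S.
    rewrite /orth/= trmx_mul trmxK -mulmxA (mulmxA _ _ (set_val U')).
    by rewrite (mulmx1C (set_valP V)) mul1mx (set_valP U' : _ = _).
  have S1 : `|1%:M - S| <= n%:R * d.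
    have -> : 1%:M - S = (set_val V)^T *m (set_val V - set_val U').
      by rewrite mulmxBr (set_valP V : _ = _).
    apply: (le_trans (normr_mulmx_le _ _)); rewrite ler_wpM2l//.
    have oVT : orth (set_val V)^T by rewrite /orth/= trmxK; apply: mulmx1C (set_valP V).
    by rewrite -[leRHS]mul1r; apply: ler_pM => //; exact: normr_orth_le1.
  have [|B [sB BS Bd]] := exists_cayley oS.
    by apply: le_trans nd; rewrite ler_wpM2l.
  have U'E : set_val U' = set_val V *m cayley B 1.
    by rewrite BS /S mulmxA (mulmx1C (set_valP V)) mul1mx.
  rewrite -(wflag_repr q) -/nu -/V pE.
  have d01 : 0 < d <= 1 by rewrite d0.
  apply: (le_trans (dist_le_path n_gt0 fM d01 mnd sB U'E)).
  rewrite lee_fin; apply: le_trans Kd.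
  have -> : K * d = n%:R * (3 * d) + n%:R * (M * (2 * (n * n)%:R *
      (n%:R * (2 * (n%:R * (n%:R * (n%:R * d))))))) by rewrite /K; ring.
  rewrite lerD2l; apply: ler_wpM2l => //; apply: ler_wpM2l => //.
  apply: ler_wpM2l; first by rewrite mulr_ge0.
  by do 4 (apply: ler_wpM2l => //); exact: le_trans Bd S1.
apply/fine_cvgP; split.
  have [e e0 eK] := key 1 ltr01.
  move/cvgrPdist_lt : xp => /(_ e e0) xe; near=> m.
  rewrite ge0_fin_numE//; apply: (@le_lt_trans _ _ 1%E); last exact: ltry.
  apply: eK; have : `|0 - sep_dist p (x m)| < e by near: m.
  by rewrite sub0r normrN ger0_norm// sep_dist_ge0.
apply/cvgrPdist_le => eta eta0; have [e e0 eK] := key eta eta0.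
move/cvgrPdist_lt : xp => /(_ e e0) xe; near=> m.
have : `|0 - sep_dist p (x m)| < e by near: m.
rewrite !sub0r !normrN ger0_norm ?sep_dist_ge0// => /eK xm.
rewrite ger0_norm /= ?fine_ge0// -lee_fin fineK//.
by rewrite ge0_fin_numE// (le_lt_trans xm)// ltry.
Unshelve. all: by end_near. Qed.

Theorem proposition4p5 (R : realType) (n : nat) (n_gt0 : (0 < n)%N)
    (f : 'rV[R]_n -> R)
    (f_ge0 : forall mu : 'rV[R]_n, cube mu -> 0 <= f mu)
    (f_lip : [lipschitz f mu | mu in @cube R n])
    (f_C2 : Ck_on 2 (@cube R n `\ 0) f)
    (f_eq0 : forall mu : 'rV[R]_n, cube mu -> (f mu = 0 <-> mu = 0))
    (x : nat -> wflag R n) (p : wflag R n) :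
  (wflag_dist f (x m) p @[m --> \oo] --> 0%E) <-> (x m @[m --> \oo] --> p).
Proof.
split; first exact: cvg_of_dist.
exact: dist_of_cvg.
Qed.
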